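(* Every Weyl group $W$ satisfies the minimum-equals-minimal property; that is, if $W$ is a Weyl group of rank $n$ and $X$ is any set of reflections of $W$ that generates $W$, then $X$ contains a subset $\{t_1,\ldots,t_n\}\subseteq X$ of exactly $n$ reflections that generates $W$.
   Context: A Coxeter group $W$ is a group with a finite generating set $S=\{s_1,\ldots,s_n\}$ (the simple generators) and a presentation $W=\langle s_1,\ldots,s_n \mid s_i^2=1,\ (s_is_j)^{m_{ij}}=1 \text{ for } i<j\rangle$ with $m_{ij}\in\{2,3,\ldots\}\cup\{\infty\}$. Its rank is $n=|S|$. A reflection of $W$ is an element conjugate in $W$ to some simple generator. A Weyl (or crystallographic) group is a finite Coxeter group (one of finite cardinality) all of whose $m_{ij}$ lie in $\{2,3,4,6\}$; Weyl groups need not be irreducible. *)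

(* Defs.v *)
From mathcomp Require Import all_boot all_fingroup.

Set Implicit Arguments.
Unset Strict Implicit.
Unset Printing Implicit Defensive.

Local Open Scope group_scope.

(* The exponents m i j are only read for i < j, and m i j = 0 encodes
   m_ij = oo: the relation (t i * t j) ^+ 0 = 1 is then vacuous. *)
Definition coxeter_relations (n : nat) (m : 'I_n -> 'I_n -> nat)
    (H : groupType) (t : 'I_n -> H) : Prop :=
  (forall i, t i ^+ 2 = 1) /\
  (forall i j : 'I_n, i < j -> (t i * t j) ^+ m i j = 1).

(* W is presented by the generators s i and the Coxeter relations of m; the
   presentation is expressed by its universal property, tested on arbitrary,
   possibly infinite, groups. The s i are listed without repetition, so that n
   is the rank. *)
Record finite_coxeter_system (W : finGroupType) (n : nat) (s : 'I_n -> W)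
    (m : 'I_n -> 'I_n -> nat) : Prop := FiniteCoxeterSystem {
  coxeter_exponents : forall i j : 'I_n, i < j -> m i j != 1%N;
  coxeter_inj : injective s;
  coxeter_gen : <<[set s i | i : 'I_n]>> = [set: W];
  coxeter_rel : coxeter_relations m s;
  coxeter_univ : forall (H : groupType) (t : 'I_n -> H),
    coxeter_relations m t ->
    exists2 f : W -> H, {morph f : x y / x * y} & forall i, f (s i) = t i
}.

Definition weyl_group (W : finGroupType) (n : nat) (s : 'I_n -> W) : Prop :=
  exists2 m : 'I_n -> 'I_n -> nat, finite_coxeter_system s m &
    forall i j : 'I_n, i < j -> m i j \in [:: 2; 3; 4; 6]%N.

Definition reflections (W : finGroupType) (n : nat) (s : 'I_n -> W) : {set W} :=
  class_support [set s i | i : 'I_n] [set: W].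

Definition minimum_equals_minimal (W : finGroupType) (n : nat)
    (s : 'I_n -> W) : Prop :=
  forall X : {set W}, X \subset reflections s -> <<X>> = [set: W] ->
    exists Y : {set W}, [/\ Y \subset X, #|Y| = n & <<Y>> = [set: W]].

(* Main.v *)
(** Through integral Cartan matrices W acts on Z^n by reflections; the action is
    faithful (Tits) and, W being finite, preserves a positive definite integral
    form, so that the reflections of W correspond to the pairs of opposite roots
    of a reduced crystallographic root system. The roots of any generating set of
    reflections span, hence it suffices that those of an irredundant one are
    linearly independent, i.e. that every minimal linear dependence (circuit)
    of roots contains a root whose reflection is generated by the others.

    Write the circuit as a sum of c_i x_i with c_i > 0 coprime, and let h be the gcd
    of the |x_i|^2 c_i. An index l with c_l = 1 and |x_l|^2 = h is redundant, by descent
    on the sum of the c_i. To find such a good index, replace x_j by its image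
    under the reflection in x_i for all j in a set J: this generates the same
    group and only changes c_i. In a circuit without good index and with
    minimal coefficient sum, the inequalities so obtained, for J of size at most
    four, leave only the coefficients 2 and 3 on the roots of norm h. Positivity
    of the form then yields a cubic graph with matched edges (vertices of coefficient
    3, edges of coefficient 2), and a closed trail in it gives a null vector that is
    not proportional to c. *)

Require Import Defs.
From mathcomp Require Import all_boot all_fingroup.
From HB Require Import structures.
From mathcomp Require Import all_order all_algebra zify ring.

Set Implicit Arguments.
Unset Strict Implicit.
Unset Printing Implicit Defensive.

Import Order.TTheory GRing.Theory Num.Theory.
Local Open Scope ring_scope.

(** * Minimal circuits *)

(** Coprime coefficients need not include a 1, so the existence of a good index is the heart of the
    matter. Goodness is a lattice condition: the relation of a circuit being unique up to a factor,
    c_l = 1 says that x_l is an integral combination of the other roots of the circuit. Passing to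
    coroots turns the c_i into |x_i|^2 c_i up to a common factor, so |x_l|^2 c_l = h says the same
    of the coroots. The descent shows that both together make x_l redundant. Reflecting some roots
    in x_i adds to c_i an integral combination of the other coefficients, and likewise in the
    relation of the coroots. Hence the gcds 1 and h survive every move, and a good index of the
    smaller circuit was already good, unless it is i itself. This exception is the origin of the
    values [c i + 1] and [c i - 1] in [move_sum]. *)

(* Indices stand for the roots x_i of a circuit [\sum_i c i * x_i = 0]; b is their
   Gram matrix and [a i j] the Cartan integer <x_j, x_i^vee>. Reflecting in x_i the
   roots x_j with j in s changes the coefficient c i into |c i - S|, up to the
   sign of x_i, and nothing else; [move_sum] says that this never leads to a
   smaller circuit without good index, and [t i j] is the contribution of j to
   the total 2 c i. *)
Section MinimalCircuit.
Variables (I : finType) (b a : I -> I -> int) (c : I -> int) (h : int).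
Hypothesis bC : forall i j, b i j = b j i.
Hypothesis b_gt0 : forall i, 0 < b i i.
Hypothesis aE : forall i j, a i j * b i i = 2 * b i j.
Hypothesis c_ge0 : forall i, 0 <= c i.
Hypothesis c_neq0 : exists i, 0 < c i.
Hypothesis c_rel : forall i, \sum_j a i j * c j = 0.
(** Product 4 belongs to proportional roots, product 3 at an obtuse angle to a G2 pair; either would
    yield a good index. *)
Hypothesis aa_le3 : forall i j, i != j -> 0 < c i -> 0 < c j -> a i j * a j i <= 3.
Hypothesis aa_le2 : forall i j, i != j -> 0 < c i -> 0 < c j -> a i j < 0 ->
  a i j * a j i <= 2.
Hypothesis h_dvd : forall i, (h %| b i i * c i)%Z.
Hypothesis not_good : forall i, c i = 1 -> b i i <> h.
Let t i j : int := - (a i j * c j).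
Hypothesis move_sum : forall i s, 0 < c i -> uniq (i :: s) ->
  let S := \sum_(j <- s) t i j in
  0 < S < 2 * c i -> (S = c i + 1 \/ S = c i - 1) /\ b i i = h.
Let bl (L L' : seq (int * I)) : int :=
  \sum_(p <- L) \sum_(q <- L') p.1 * q.1 * b p.2 q.2.
Let coef (L : seq (int * I)) k : int := \sum_(p <- L) (if p.2 == k then p.1 else 0).
Hypothesis bl_ge0 : forall L, 0 <= bl L L.
(** Positive definiteness and uniqueness of the relation in one: a combination of norm at most 0 is
    a relation, hence a multiple of [c]. *)
Hypothesis null_vector : forall L, (forall p, p \in L -> 0 < c p.2) ->
  bl L L <= 0 -> forall i j, coef L i * c j = coef L j * c i.

(* The roots of the only length for which c i = 1 would make i good. *)
Let special i := b i i = h.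

(** * Contributions and the constraints imposed by moves *)

Lemma cartan_sym i j : a i j * b i i = a j i * b j j.
Proof. by rewrite !aE bC. Qed.

Lemma cartan_lt0 i j : a i j < 0 -> a j i < 0.
Proof. by move: (cartan_sym i j) (b_gt0 i) (b_gt0 j); nia. Qed.

Lemma cartan_diag i : a i i = 2.
Proof. by move: (aE i i) (b_gt0 i); nia. Qed.

Lemma sum_contrib i : \sum_(j | j != i) t i j = 2 * c i.
Proof.
move: (c_rel i); rewrite (bigD1 i) //= cartan_diag sumrN => /eqP.
by rewrite addr_eq0 => /eqP ->.
Qed.

Lemma sum_contrib_supp i :
  \sum_(j | (j != i) && (0 < t i j)) t i j >= 2 * c i.
Proof.
rewrite -(sum_contrib i) (bigID (fun j => 0 < t i j)) /= gerDl.
by apply: sumr_le0 => j /andP[_]; rewrite -leNgt.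
Qed.

Lemma contrib_gt0 i j : 0 < t i j -> 0 < c j /\ a i j < 0.
Proof.
move=> t0; have cj : 0 < c j.
  by rewrite lt_neqAle c_ge0 andbT eq_sym; apply: contraTneq t0 => e; rewrite /t e; lia.
by split=> //; move: t0; rewrite /t oppr_gt0 pmulr_llt0.
Qed.

Lemma special_ge2 i : 0 < c i -> special i -> 2 <= c i.
Proof.
move=> ci si; have := @not_good i; case: (c i =P 1) => [e1 /(_ e1)//|]; lia.
Qed.

(** The two contributions have product at most 2 ci cj, so they cannot both reach twice their
    coefficient: one of the norms is h. A double bond makes the norms differ, and the inequality at
    the other end then selects -1 rather than +1. *)
Lemma negpair_arith (p q ai aj ci cj : int) :
  0 < p -> 0 < q -> 0 < ci -> 0 < cj -> ai * p = aj * q -> ai < 0 -> aj < 0 ->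
  ai * aj <= 2 ->
  2 * ci <= - (ai * cj) \/
    (- (ai * cj) = ci + 1 \/ - (ai * cj) = ci - 1) /\ p = h ->
  2 * cj <= - (aj * ci) \/
    (- (aj * ci) = cj + 1 \/ - (aj * ci) = cj - 1) /\ q = h ->
  (p = h -> 2 <= ci) -> (q = h -> 2 <= cj) ->
  [\/ [/\ p = h, q = h, ai = -1, aj = -1 & cj = ci + 1 \/ cj = ci - 1],
      [/\ p = h, q <> h, - (ai * cj) = ci - 1, 2 * cj <= - (aj * ci) &
        ai = -1 /\ aj = -2 \/ ai = -2 /\ aj = -1] |
      [/\ q = h, p <> h, - (aj * ci) = cj - 1, 2 * ci <= - (ai * cj) &
        ai = -1 /\ aj = -2 \/ ai = -2 /\ aj = -1]].
Proof.
move=> p0 q0 i0 j0 epq ai0 aj0 aa H1 H2 pi qi.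
have : [\/ ai = -1 /\ aj = -1, ai = -1 /\ aj = -2 | ai = -2 /\ aj = -1].
  have h1 : -2 <= ai by nia.
  have h2 : -2 <= aj by nia.
  have [e|e] : ai = -1 \/ ai = -2 by lia.
    rewrite e; have [->|->] : aj = -1 \/ aj = -2 by lia.
      exact: Or31.
    exact: Or32.
  have -> : aj = -1 by rewrite e in aa; lia.
  rewrite e.
  exact: Or33.
case=> -[e1 e2]; rewrite e1 e2 in epq H1 H2 aa ai0 aj0 *.
- apply: Or31; split; lia.
- case: (q =P h) => qh; [apply: Or33|apply: Or32]; split; try lia.
- case: (q =P h) => qh; [apply: Or33|apply: Or32]; split; try lia.
Qed.

Lemma move1 i j : 0 < c i -> j != i -> 0 < t i j ->
  2 * c i <= t i j \/ (t i j = c i + 1 \/ t i j = c i - 1) /\ special i.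
Proof.
move=> ci ji tp; case: (lerP (2 * c i) (t i j)) => H; first by left.
right; have := @move_sum i [:: j] ci; rewrite /= big_seq1 inE eq_sym ji.
by move=> /(_ isT); rewrite tp H => /(_ isT).
Qed.

Lemma move_cases i s : 0 < c i -> uniq (i :: s) ->
  let S := \sum_(j <- s) t i j in
  S <= 0 \/ 2 * c i <= S \/ (S = c i + 1 \/ S = c i - 1) /\ special i.
Proof.
move=> ci us S; case: (lerP S 0) => S0; first by left.
case: (lerP (2 * c i) S) => S2; first by right; left.
by right; right; apply: move_sum => //; rewrite -/S S0.
Qed.

Lemma move2 i j k : 0 < c i -> j != i -> k != i -> j != k ->
  let S := t i j + t i k in
  S <= 0 \/ 2 * c i <= S \/ (S = c i + 1 \/ S = c i - 1) /\ special i.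
Proof.
move=> ci ji ki jk; have := @move_cases i [:: j; k] ci.
rewrite !big_cons big_nil addr0; apply.
by rewrite /= !inE negb_or !(eq_sym i) ji ki jk.
Qed.

Lemma move3 i j k l : 0 < c i -> uniq [:: i; j; k; l] ->
  let S := t i j + t i k + t i l in
  S <= 0 \/ 2 * c i <= S \/ (S = c i + 1 \/ S = c i - 1) /\ special i.
Proof.
move=> ci us; have := @move_cases i [:: j; k; l] ci us.
by rewrite !big_cons big_nil addr0 addrA.
Qed.

Lemma move4 i j k l m : 0 < c i -> uniq [:: i; j; k; l; m] ->
  let S := t i j + t i k + t i l + t i m in
  S <= 0 \/ 2 * c i <= S \/ (S = c i + 1 \/ S = c i - 1) /\ special i.
Proof.
move=> ci us; have := @move_cases i [:: j; k; l; m] ci us.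
by rewrite !big_cons big_nil addr0 !addrA.
Qed.

Lemma negpair i j : 0 < c i -> j != i -> 0 < t i j ->
  [\/ [/\ special i, special j, a i j = -1, a j i = -1 &
        c j = c i + 1 \/ c j = c i - 1],
      [/\ special i, ~ special j, t i j = c i - 1, 2 * c j <= t j i &
        a i j = -1 /\ a j i = -2 \/ a i j = -2 /\ a j i = -1] |
      [/\ special j, ~ special i, t j i = c j - 1, 2 * c i <= t i j &
        a i j = -1 /\ a j i = -2 \/ a i j = -2 /\ a j i = -1]].
Proof.
move=> ci ji tp; have [cj aij] := contrib_gt0 tp.
have aji := cartan_lt0 aij.
have tp' : 0 < t j i by rewrite /t oppr_gt0 pmulr_llt0.
have ij : i != j by rewrite eq_sym.
apply: (negpair_arith (b_gt0 i) (b_gt0 j)) => //.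
- exact: cartan_sym.
- exact: aa_le2.
- exact: move1.
- exact: move1.
- by move=> *; exact: special_ge2.
- by move=> *; exact: special_ge2.
Qed.

Lemma negnbr i : 0 < c i -> exists j, j != i /\ 0 < t i j.
Proof.
move=> ci; have := sum_contrib_supp i.
case: (pickP (fun j => (j != i) && (0 < t i j))) => [j /andP[? ?] _|n0].
  by exists j.
by rewrite big_pred0 //; lia.
Qed.

Lemma special_exists : exists i, 0 < c i /\ special i.
Proof.
have [i ci] := c_neq0; have [j [ji tp]] := negnbr ci.
have [cj _] := contrib_gt0 tp.
by case: (negpair ci ji tp) => -[? ? *]; [exists i|exists i|exists j].
Qed.

(** The positive contributions add up to at least 2 c i, which a single one bounded by [M] cannot
    provide. *)
Lemma two_negnbrs i M : 0 < c i -> M < 2 * c i ->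
  (forall j, j != i -> 0 < t i j -> t i j <= M) ->
  exists j k, [/\ j != i, k != i, j != k, 0 < t i j & 0 < t i k].
Proof.
move=> ci Mi tM; have [j [ji tj]] := negnbr ci; exists j.
have := sum_contrib_supp i; rewrite (bigD1 j) /= ?ji ?tj //.
case: (pickP (fun k => (k != i) && (0 < t i k) && (k != j))).
  by move=> k /andP[/andP[? ?] kj] _; exists k; split=> //; rewrite eq_sym.
move=> n0; rewrite big_pred0 // => H; move: (tM _ ji tj); lia.
Qed.

(** At a special index with the largest coefficient C every positive contribution is C - 1. Two of
    them form a move of sum 2 C - 2, which has to be C + 1, since C = 1 would make the index
    good. *)
Lemma special_le3 i : 0 < c i -> special i -> c i <= 3.
Proof.
have [i0 [ci0 si0]] := special_exists.
pose P i := (0 < c i) && (b i i == h).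
have Pi0 : P i0 by rewrite /P ci0; apply/eqP.
case: (@arg_maxnP I i0 P (fun i => absz (c i)) Pi0) => m /andP[cm /eqP sm] mx.
move=> ci si; have : c i <= c m.
  by have := mx i; rewrite /P ci => /(_ (introT eqP si)); move: (c_ge0 i); lia.
have -> // : c m = 3.
have tE j : j != m -> 0 < t m j -> t m j = c m - 1.
  move=> jm tj; have [cj _] := contrib_gt0 tj.
  case: (negpair cm jm tj) => [[_ sj e _]|[]//|[]//].
  have : c j <= c m.
    by have := mx j; rewrite /P cj => /(_ (introT eqP sj)); lia.
  by rewrite /t e; lia.
have [|j jm tp|j [k [jm km jk tj tk]]] := @two_negnbrs m (c m - 1) cm.
- lia.
- by rewrite (tE j jm tp).
have := move2 cm jm km jk; rewrite /= (tE j) // (tE k) //.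
by move: (special_ge2 cm sm); lia.
Qed.

Lemma special_c i : 0 < c i -> special i -> c i = 2 \/ c i = 3.
Proof. by move=> ci si; move: (special_ge2 ci si) (special_le3 ci si); lia. Qed.

(* N turns out to be empty; then T and D are the vertices and the edges of a cubic
   graph, whose edges are matched by [pt] below. *)
Let T i := special i /\ c i = 3.
Let D i := special i /\ c i = 2.
Let N i := ~ special i /\ 0 < c i.

(** * Neighbourhoods of the three kinds of roots *)

Lemma TDN i : 0 < c i -> [\/ T i, D i | N i].
Proof.
move=> ci; case: (b i i =P h) => si; last by apply: Or33.
by case: (special_c ci si) => e; [apply: Or32|apply: Or31].
Qed.

(** A neighbour of coefficient 2 would leave [k] with coefficient 1 and norm h / 2, against [h_dvd].
    For coefficient 3 the two directions of the double bond give the two classes. *)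
Lemma N_negnbr k i : N k -> i != k -> 0 < t k i ->
  [/\ T i, t i k = 2, t k i = 3 * c k & b k k = 2 * h /\ c k = 1 \/
     h = 2 * b k k /\ c k = 2].
Proof.
move=> [nk ck] ik tk; have [ci _] := contrib_gt0 tk.
case: (negpair ck ik tk) => [[]//|[]//|[si _ e H]].
move: (cartan_sym k i) (h_dvd k); rewrite si => qe hd.
have h0 : 0 < h by rewrite -si.
case: (special_c ci si) => e'.
  move: e; rewrite e' /t => e [[a1 a2]|[a1 a2]]; first by rewrite a2 in e; lia.
  rewrite a2 in e; rewrite a1 a2 in qe H; have ck1 : c k = 1 by lia.
  have hb : h = 2 * b k k by lia.
  move: hd; rewrite ck1 mulr1 => /dvdzP[q]; rewrite hb => eb.
  have : b k k * (1 - 2 * q) = 0 by lia.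
  by move/eqP; rewrite mulf_eq0 gt_eqF //= => /eqP; lia.
move: e; rewrite e' /t => e [] [a1 a2]; rewrite a2 in e; rewrite a1 a2 in qe H.
  split; first by split.
  - by rewrite /t a2; lia.
  - by rewrite /t a1 e'; lia.
  - by left; lia.
split; first by split.
- by rewrite /t a2; lia.
- by rewrite /t a1 e'; lia.
- by right; lia.
Qed.

Lemma N_class k : N k -> b k k = 2 * h /\ c k = 1 \/ h = 2 * b k k /\ c k = 2.
Proof.
move=> Nk; have [_ ck] := Nk; have [i [ik tk]] := negnbr ck.
by have [] := N_negnbr Nk ik tk.
Qed.

Lemma contrib_neg i j : 0 < c i -> t i j < 0 ->
  [/\ 0 < c j, 0 < a i j, 0 < a j i & t j i < 0].
Proof.
move=> ci tn; have cj : 0 < c j.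
  rewrite lt_neqAle c_ge0 andbT eq_sym; apply: contraTneq tn => e.
  by rewrite /t e; lia.
have aij : 0 < a i j by move: tn; rewrite /t oppr_lt0 pmulr_lgt0.
have aji : 0 < a j i.
  by move: (cartan_sym i j) (b_gt0 i) (b_gt0 j); nia.
by split=> //; rewrite /t oppr_lt0 mulr_gt0.
Qed.

Lemma contrib_pos i j : 0 < c i -> 0 < t i j -> 0 < t j i.
Proof.
move=> ci tp; have [cj /cartan_lt0 aji] := contrib_gt0 tp.
by rewrite /t oppr_gt0 pmulr_llt0.
Qed.

Lemma special_cartan i j : special i -> special j -> a i j = a j i.
Proof.
move=> si sj; move: (cartan_sym i j) (b_gt0 i); rewrite si sj => e h0.
by apply: (mulIf _ e); rewrite gt_eqF.
Qed.

Lemma special_neg i j : special i -> special j -> j != i -> 0 < c i -> t i j < 0 ->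
  a i j = 1.
Proof.
move=> si sj ji ci tn; have [cj a1 a2 _] := contrib_neg ci tn.
have ij : i != j by rewrite eq_sym.
have := aa_le3 ij ci cj; rewrite -(special_cartan si sj); nia.
Qed.

Lemma N_special k i : N k -> special i -> 0 < c i -> i != k -> t k i < 0 ->
  t k i = - (c k * c i) /\ t i k = -2.
Proof.
move=> Nk si ci ik tn; have [nk ck] := Nk.
have [_ a1 a2 _] := contrib_neg ck tn.
have := aa_le3 ik ci ck; have := cartan_sym k i; rewrite si.
case: (N_class Nk) => -[e e'].
  rewrite e => H H1.
  have e2 : a i k = 2 * a k i.
    by apply: (@mulIf _ h); rewrite ?gt_eqF -?si //; move: H; rewrite si; lia.
  have a1' : a k i = 1 by rewrite e2 in H1; nia.
  by rewrite /t e2 a1' e'; lia.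
rewrite e => H H1.
have e2 : a k i = 2 * a i k.
  by apply: (@mulIf _ (b k k)); rewrite ?gt_eqF //; lia.
have a1' : a i k = 1 by rewrite e2 in H1; nia.
by rewrite /t e2 a1' e'; lia.
Qed.

Lemma T_neg i j : T i -> j != i -> 0 < t i j -> t i j = 2 /\ ~ T j.
Proof.
move=> [si ci] ji tj; have [cj _] := contrib_gt0 tj.
have ci0 : 0 < c i by rewrite ci.
case: (negpair ci0 ji tj) => [[_ sj e _ H]|[_ nj e _ _]|[]//].
  move: (special_le3 cj sj) => H'; rewrite /t e.
  by split; [lia|case; lia].
by split; [lia|case].
Qed.

(** A root [j] of coefficient 3 would contribute -3; together with two obtuse neighbours,
    contributing 2 each, it would give a move of sum 1, neither 2 nor 4. *)
Lemma T_pos i j : T i -> j != i -> t i j < 0 -> t i j = -2 /\ ~ T j.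
Proof.
move=> Ti ji tn; have [si ci] := Ti; have ci0 : 0 < c i by rewrite ci.
have [cj _ _ _] := contrib_neg ci0 tn.
case: (TDN cj) => [[sj ej]|[sj ej]|Nj].
- have [||k [l [ki li kl tk tl]]] := @two_negnbrs i 2 ci0; first by rewrite ci.
    by move=> k ki /(T_neg Ti ki)[-> _].
  have := @move3 i k l j ci0; have [-> _] := T_neg Ti ki tk.
  have [-> _] := T_neg Ti li tl.
  have -> : t i j = -3 by rewrite /t (special_neg si sj ji ci0 tn) ej.
  rewrite ci /= !inE !negb_or !(eq_sym i) ki li ji kl /=.
  have kj : k != j by apply: contraTneq tk => ->; rewrite -leNgt ltW.
  have lj : l != j by apply: contraTneq tl => ->; rewrite -leNgt ltW.
  by rewrite kj lj => /(_ isT); lia.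
- rewrite /t (special_neg si sj ji ci0 tn) ej; split=> //.
  by move=> [_]; rewrite ej.
- have ij : i != j by rewrite eq_sym.
  have [_ _ _ tn'] := contrib_neg ci0 tn.
  have [_ ->] := N_special Nj si ci0 ij tn'; split=> //.
  by case: Nj => nj _ [].
Qed.

Lemma T_contrib i j : T i -> j != i -> t i j = 2 \/ t i j = 0 \/ t i j = -2.
Proof.
move=> Ti ji; case: (ltgtP (t i j) 0) => H; last by right; left.
  by right; right; have [] := T_pos Ti ji H.
by left; have [] := T_neg Ti ji H.
Qed.

Lemma TT_contrib i j : T i -> T j -> j != i -> t i j = 0.
Proof.
move=> Ti Tj ji; case: (ltgtP (t i j) 0) => // H.
  by have [] := T_pos Ti ji H.
by have [] := T_neg Ti ji H.
Qed.

Lemma D_neg j k : D j -> k != j -> 0 < t j k -> T k /\ t j k = 3.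
Proof.
move=> [sj cj] kj tk; have [ck _] := contrib_gt0 tk.
have cj0 : 0 < c j by rewrite cj.
case: (negpair cj0 kj tk) => [[_ sk e _ H]|[_ nk e _ _]|[]//].
  have ck3 : c k = 3 by move: (special_ge2 ck sk); lia.
  by split; [split|rewrite /t e ck3].
have jk : j != k by rewrite eq_sym.
by have [[_ e'] _ _ _] := @N_negnbr k j (conj nk ck) jk (contrib_pos cj0 tk); lia.
Qed.

Lemma D_pos j k : D j -> k != j -> t j k < 0 ->
  T k /\ t j k = -3 \/ ~ T k /\ t j k = -2.
Proof.
move=> Dj kj tn; have [sj cj] := Dj; have cj0 : 0 < c j by rewrite cj.
have [ck _ _ tn'] := contrib_neg cj0 tn.
case: (TDN ck) => [Tk|[sk ek]|Nk].
- left; split=> //; case: Tk => sk ek.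
  by rewrite /t (special_neg sj sk kj cj0 tn) ek.
- right; split; first by move=> [_]; rewrite ek.
  by rewrite /t (special_neg sj sk kj cj0 tn) ek.
right; split; first by case: Nk => nk _ [].
by have jk : j != k; [rewrite eq_sym|have [_ ->] := N_special Nk sj cj0 jk tn'].
Qed.

(** Roots in T contribute multiples of 3 to the total 4, so some root outside T contributes -2. A
    second one, together with two obtuse neighbours, would give the forbidden move of sum 3 + 3 - 2
    - 2 = [c j]. *)
Lemma D_partner j : D j -> exists p, [/\ p != j, ~ T p, t j p = -2 &
  forall k, k != j -> k != p -> ~ T k -> t j k = 0].
Proof.
move=> Dj; have [sj cj] := Dj; have cj0 : 0 < c j by rewrite cj.
case: (pickP (fun p => [&& p != j, t j p < 0 & ~~ (b p p == h) || (c p != 3)])).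
  move=> p /and3P[pj tp np].
  have nTp : ~ T p by move=> [sp cp]; move: np; rewrite cp sp !eqxx.
  have tpE : t j p = -2 by case: (D_pos Dj pj tp) => -[].
  exists p; split=> // k kj kp nTk.
  case: (ltgtP (t j k) 0) => // tk; last by have [] := D_neg Dj kj tk.
  have tkE : t j k = -2 by case: (D_pos Dj kj tk) => -[].
  have [||u [v [uj vj uv tu tv]]] := @two_negnbrs j 3 cj0; first by rewrite cj.
    by move=> u uj /(D_neg Dj uj)[_ ->].
  have [Tu tuE] := D_neg Dj uj tu; have [Tv tvE] := D_neg Dj vj tv.
  have := @move4 j u v p k cj0.
  rewrite tuE tvE tpE tkE cj /= !inE !negb_or !(eq_sym j) uj vj uv pj kj /=.
  rewrite (eq_sym p) kp.
  have -> : u != p by apply: contraPneq Tu => ->.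
  have -> : u != k by apply: contraPneq Tu => ->.
  have -> : v != p by apply: contraPneq Tv => ->.
  have -> : v != k by apply: contraPneq Tv => ->.
  by move=> /(_ isT); lia.
move=> n0; exfalso.
have /dvdzP[q] : (3 %| \sum_(k | k != j) t j k)%Z.
  apply: rpred_sum => k kj; case: (ltgtP (t j k) 0) => [tk|tk|->].
  - case: (D_pos Dj kj tk) => -[nT ->] //.
    move: (n0 k); rewrite kj tk /= => /negbT; rewrite negb_or !negbK.
    by case/andP=> /eqP sk /eqP ck; case: nT.
  - by have [_ ->] := D_neg Dj kj tk.
  - exact: dvdz0.
by rewrite sum_contrib cj; lia.
Qed.

(** An obtuse neighbour of [k] contributes 3 c k, and an acute [j] in D contributes - 2 c k; the
    resulting sum c k is forbidden. *)
Lemma N_D_contrib k j : N k -> D j -> j != k -> t k j = 0.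
Proof.
move=> Nk Dj jk; have [nk ck] := Nk; have [sj cj] := Dj.
case: (ltgtP (t k j) 0) => // tj; last first.
  by have [[_ e] _ _ _] := N_negnbr Nk jk tj; lia.
have cj0 : 0 < c j by rewrite cj.
have [e _] := N_special Nk sj cj0 jk tj.
have [i [ik ti]] := negnbr ck; have [Ti _ e' _] := N_negnbr Nk ik ti.
have ij : i != j by apply: contraPneq Ti => -> [_]; lia.
by case: (move2 ck ik jk ij) => [|[|[_ /nk]//]]; rewrite e e' cj; lia.
Qed.

Lemma D_N_contrib k j : N k -> D j -> j != k -> t j k = 0.
Proof.
move=> Nk Dj jk; have [sj cj] := Dj; have cj0 : 0 < c j by rewrite cj.
have := N_D_contrib Nk Dj jk; case: (ltgtP (t j k) 0) => // tk.
  by have [_ _ _] := contrib_neg cj0 tk; lia.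
by have := contrib_pos cj0 tk; lia.
Qed.

(** Across the two classes of [N_class] the norms differ by a factor 4, and the Cartan integers
    would have product at least 4. *)
Lemma N_N_neg k l : N k -> N l -> l != k -> t k l < 0 ->
  [/\ c l = c k, b l l = b k k & a k l = 1].
Proof.
move=> Nk Nl lk tn; have [nk ck] := Nk; have [nl cl] := Nl.
have [_ a1 a2 _] := contrib_neg ck tn.
have kl : k != l by rewrite eq_sym.
have := aa_le3 kl ck cl; have := cartan_sym k l.
have bk := b_gt0 k; have bll := b_gt0 l.
have eq_case : b l l = b k k -> a k l * b k k = a l k * b l l ->
    a k l * a l k <= 3 -> a k l = 1.
  move=> -> /(mulIf _) -> //; [nia|by rewrite gt_eqF].
case: (N_class Nk) => -[e1 e2]; case: (N_class Nl) => -[e3 e4] H1 H2.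
- have e : b l l = b k k by lia.
  by split; [lia|lia|exact: eq_case].
- have e : 4 * a k l = a l k.
    have eb : b k k = 4 * b l l by lia.
    by apply: (@mulIf _ (b l l)); [rewrite gt_eqF|rewrite eb in H1; lia].
  by rewrite -e in H2; nia.
- have e : a k l = 4 * a l k.
    have eb : b l l = 4 * b k k by lia.
    by apply: (@mulIf _ (b k k)); [rewrite gt_eqF|rewrite eb in H1; lia].
  by rewrite e in H2; nia.
- have e : b l l = b k k by lia.
  by split; [lia|lia|exact: eq_case].
Qed.

Lemma N_N_nonpos k l : N k -> ~ T l -> l != k -> t k l <= 0.
Proof.
move=> Nk nT lk; rewrite leNgt; apply/negP => tl.
by have [] := N_negnbr Nk lk tl.
Qed.

(** The argument of [D_partner]: T contributes multiples of 3 c k to a total of 2 c k, and two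
    partners would give a move of sum 3 c k - c k - c k = c k. *)
Lemma N_partner k : N k -> exists p, [/\ p != k, N p, c p = c k /\ b p p = b k k,
  a k p = 1 & forall l, 0 < c l -> l != k -> l != p -> ~ T l -> t k l = 0].
Proof.
move=> Nk; have [nk ck] := Nk.
have [i [ik ti]] := negnbr ck; have [Ti _ eti _] := N_negnbr Nk ik ti.
have negN l : 0 < c l -> l != k -> ~ T l -> t k l < 0 ->
    [/\ N l, c l = c k, b l l = b k k & a k l = 1].
  move=> cl lk nT tl; have Nl : N l.
    by case: (TDN cl) => // Dl; move: tl; rewrite N_D_contrib.
  by have [? ? ?] := N_N_neg Nk Nl lk tl.
case: (pickP (fun p => [&& p != k, t k p < 0 & ~~ (b p p == h) || (c p != 3)])).
  move=> p /and3P[pk tp np].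
  have nTp : ~ T p by move=> [sp cp]; move: np; rewrite cp sp !eqxx.
  have [cp _ _ _] := contrib_neg ck tp.
  have [Np ecp ebp eap] := negN p cp pk nTp tp.
  exists p; split=> // l cl lk lp nTl; apply/eqP.
  rewrite eq_le N_N_nonpos //= leNgt; apply/negP => tl.
  have [Nl ecl _ eal] := negN l cl lk nTl tl.
  have := @move3 k i p l ck.
  have -> : uniq [:: k; i; p; l].
    rewrite /= !inE !negb_or !(eq_sym k) ik pk lk (eq_sym p) lp /= andbT.
    have -> : i != p by apply: contraPneq Ti => ->.
    by apply: contraPneq Ti => ->.
  move=> /(_ isT); rewrite eti /t eap eal ecp ecl.
  by case=> [|[|[_ /nk]]]; lia.
move=> n0; exfalso.
have /dvdzP[q] : (3 * c k %| \sum_(l | l != k) t k l)%Z.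
  apply: rpred_sum => l lk; case: (ltgtP (t k l) 0) => [tl|tl|->].
  - have [cl _ _ _] := contrib_neg ck tl.
    move: (n0 l); rewrite lk tl /= => /negbT; rewrite negb_or !negbK.
    case/andP=> /eqP sl /eqP el.
    have [-> _] := N_special Nk sl cl lk tl; rewrite el.
    by apply/dvdzP; exists (-1); lia.
  - by have [_ _ -> _] := N_negnbr Nk lk tl; exact: dvdzz.
  - exact: dvdz0.
rewrite sum_contrib => e.
have /eqP : c k * (2 - 3 * q) = 0 by lia.
by rewrite mulf_eq0 gt_eqF //= => /eqP; lia.
Qed.

Lemma contrib0_b i j : 0 < c j -> t i j = 0 -> b i j = 0.
Proof.
move=> cj /eqP; rewrite /t oppr_eq0 mulf_eq0 (gt_eqF cj) orbF => /eqP e.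
by move: (aE i j); rewrite e; lia.
Qed.

Let nT j := 0 < c j /\ ~ T j.

(** The roots outside T fall into pairs at an angle of 60 degrees, spanning mutually orthogonal
    planes of type A2. The condition stands under the existential so that a choice function on all
    of [I] can be extracted. *)
Lemma partner_exists j : exists p, nT j -> [/\ p != j, nT p,
  c p = c j /\ b p p = b j j, 2 * b j p = b j j &
  forall l, nT l -> l != j -> l != p -> b j l = 0].
Proof.
case: (ltrP 0 (c j)) => cj; last by exists j => -[]; lia.
case: (TDN cj) => [Tj|Dj|Nj]; first by exists j => -[].
  have [p [pj nTp tp H]] := D_partner Dj; exists p => _.
  have tp0 : t j p < 0 by rewrite tp.
  have [cp _ _ _] := contrib_neg cj tp0.
  have [sj ej] := Dj.
  have [sp ep] : D p.
    by case: (TDN cp) => // Np; move: tp; rewrite (D_N_contrib Np) // eq_sym.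
  split=> //; first by rewrite ep ej sp sj.
    rewrite -aE; have -> : a j p = 1 by move: tp; rewrite /t ep; lia.
    exact: mul1r.
  by move=> l [cl nTl] lj lp; apply: contrib0_b => //; exact: H.
have [p [pj Np eq ap H]] := N_partner Nj; exists p => _.
have [np cp] := Np; split=> //; first by split=> // -[].
  by rewrite -aE ap mul1r.
by move=> l [cl nTl] lj lp; apply: contrib0_b => //; exact: H.
Qed.

Lemma bl_catl L1 L2 L : bl (L1 ++ L2) L = bl L1 L + bl L2 L.
Proof. by rewrite /bl big_cat. Qed.

Lemma bl_sym L1 L2 : bl L1 L2 = bl L2 L1.
Proof.
rewrite /bl exchange_big /=; apply: eq_bigr => p _; apply: eq_bigr => q _.
by rewrite bC (mulrC p.1).
Qed.

Lemma bl_catr L1 L2 L : bl L (L1 ++ L2) = bl L L1 + bl L L2.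
Proof. by rewrite !(bl_sym L) bl_catl. Qed.

Lemma bl_nil L : bl L [::] = 0.
Proof. by rewrite bl_sym /bl big_nil. Qed.

Lemma coef_cat L1 L2 k : coef (L1 ++ L2) k = coef L1 k + coef L2 k.
Proof. by rewrite /coef big_cat. Qed.

Section Partner.
Variable pt : I -> I.
Hypothesis ptP : forall j, nT j -> [/\ pt j != j, nT (pt j),
  c (pt j) = c j /\ b (pt j) (pt j) = b j j, 2 * b j (pt j) = b j j &
  forall l, nT l -> l != j -> l != pt j -> b j l = 0].

(* The rescaled roots [w j] x_j, for j in N, behave as roots whose norm is twice
   that of the special ones. *)
Let w j : int := if b j j == h then 1 else c j.
Let eta j : int := if b j j == h then 1 else 2.

Lemma w_norm j : nT j -> w j * w j * b j j = eta j * h.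
Proof.
move=> [cj nTj]; rewrite /w /eta; case: eqP => [->|nj]; first by lia.
by case: (@N_class j (conj nj cj)) => -[e1 e2]; rewrite e2; lia.
Qed.

Lemma w_pt j : nT j -> w (pt j) = w j.
Proof. by move=> /ptP[_ _ [e1 e2] _ _]; rewrite /w e1 e2. Qed.

Lemma h_gt0 : 0 < h.
Proof. by have [i [_ <-]] := special_exists. Qed.

(** * Projections of a root of coefficient 3 to the planes of the pairs *)

Section Touch.
Variable i : I.
Hypothesis Ti : T i.
Let al j : int := (t i j %/ 2)%Z.

Lemma nT_neq j : nT j -> j != i.
Proof. by move=> [_ H]; apply/eqP => e; apply: H; rewrite e. Qed.

Lemma alE j : j != i -> t i j = 2 * al j.
Proof. by move=> ji; rewrite /al; case: (T_contrib Ti ji) => [->|[->|->]]. Qed.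

Lemma al_bound j : j != i -> -1 <= al j <= 1.
Proof. by move=> ji; rewrite /al; case: (T_contrib Ti ji) => [->|[->|->]]. Qed.

Lemma w_T j : nT j -> 2 * (w j * b i j) = - (al j * (eta j * h)).
Proof.
move=> nTj; have [cj nt] := nTj; have := alE (nT_neq nTj); have := aE i j.
have [si _] := Ti; rewrite si /w /eta /t; case: eqP => [sj|nj].
  have -> : c j = 2 by case: (special_c cj sj) => // e; case: nt.
  by move=> H1 H2; have -> : al j = - a i j; lia.
move=> H1 H2; have -> : 2 * (c j * b i j) = c j * a i j * h by lia.
have -> : c j * a i j = -2 * al j by lia.
lia.
Qed.

(* [L s] is three times the component of x_i orthogonal to the planes spanned by
   the pairs x_j, x_(pt j) for j in s. *)
Let u j := 2 * al j - al (pt j).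
Let v j := 2 * al (pt j) - al j.
Let Q j := al j ^+ 2 - al j * al (pt j) + al (pt j) ^+ 2.
Let P j := [:: (u j * w j, j); (v j * w j, pt j)].
Let L s := (3, i) :: flatten [seq P j | j <- s].

Lemma bl_PP j : nT j -> bl (P j) (P j) = 3 * Q j * (eta j * h).
Proof.
move=> nTj; have [_ _ [_ e1] e2 _] := ptP nTj.
rewrite /bl !big_cons !big_nil /= e1 (bC (pt j) j).
have := w_norm nTj.
set W := w j; set B := b j j in e2 *; move: e2; set B' := b j (pt j) => e2 e.
have -> : B = 2 * B' by lia.
have {}e : eta j * h = 2 * (W * W * B') by lia.
rewrite e /u /v /Q; ring.
Qed.

Lemma bl_iP j : nT j -> bl [:: (3, i)] (P j) = - (3 * Q j * (eta j * h)).
Proof.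
move=> nTj; have [_ nTp [e0 e1] e2 _] := ptP nTj.
rewrite /bl !big_cons !big_nil /=.
have H1 := w_T nTj; have H2 := w_T nTp; rewrite (w_pt nTj) in H2.
have eE : eta (pt j) = eta j by rewrite /eta e1.
rewrite eE in H2.
apply: (@mulfI _ 2) => //.
rewrite !addr0.
transitivity (3 * (u j * (2 * (w j * b i j)) + v j * (2 * (w j * b i (pt j))))).
  ring.
rewrite H1 H2 /u /v /Q; ring.
Qed.

Lemma pt_inj j k : nT j -> nT k -> pt j = pt k -> j = k.
Proof.
move=> nTj nTk e; have [pj nTp _ e2 _] := ptP nTj.
have [_ _ [_ b1] _ H] := ptP nTp; have [pk _ _ e2' _] := ptP nTk.
case: (j =P k) => // /eqP jk; exfalso.
have bj := b_gt0 j; have bk := b_gt0 k.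
have bpj : b (pt j) j != 0 by rewrite bC; lia.
have bpk : b (pt j) k != 0 by rewrite bC e; lia.
have e3 : j = pt (pt j).
  apply/eqP; apply: contraNT bpj => H'; apply/eqP; apply: H => //.
  by rewrite eq_sym.
have e4 : k = pt (pt j).
  apply/eqP; apply: contraNT bpk => H'; apply/eqP; apply: H => //.
  by rewrite e eq_sym.
by move: jk; rewrite {1}e3 {1}e4 eqxx.
Qed.

Lemma ptK j : nT j -> pt (pt j) = j.
Proof.
move=> nTj; have [pj nTp _ e2 _] := ptP nTj.
have [_ _ _ _ H] := ptP nTp; have bj := b_gt0 j.
apply/eqP; apply: contraTT isT => H'.
have : b (pt j) j = 0 by apply: H => //; rewrite eq_sym.
by rewrite bC; lia.
Qed.

Lemma bl_P_P j k : nT j -> nT k -> j != k -> k != pt j -> bl (P j) (P k) = 0.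
Proof.
move=> nTj nTk jk kp; have [pj nTp _ _ Hj] := ptP nTj.
have [pk nTpk _ _ Hk] := ptP nTk; have [_ _ _ _ Hp] := ptP nTp.
have jpk : j != pt k by apply: contraNneq kp => ->; rewrite ptK.
have pp : pt k != pt j by apply: contraNneq jk => /(pt_inj nTk nTj)->.
rewrite /bl !big_cons !big_nil /= (Hj k) ?(Hj (pt k)) ?(Hp k) ?(Hp (pt k)) //.
- by rewrite !mulr0 !addr0.
- by rewrite ptK // eq_sym.
- by rewrite ptK // eq_sym.
- by rewrite eq_sym.
- by rewrite eq_sym.
Qed.

Let F s := flatten [seq P j | j <- s].

Lemma F_cons j s : F (j :: s) = P j ++ F s.
Proof. by []. Qed.

Lemma L_cat s : L s = [:: (3, i)] ++ F s.
Proof. by []. Qed.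

Lemma bl_P_L j s : nT j -> (forall k, k \in s -> nT k) -> j \notin s ->
  pt j \notin s -> bl (P j) (F s) = 0.
Proof.
move=> nTj; elim: s => [|k s IH] ns; first by rewrite bl_nil.
rewrite F_cons !inE !negb_or => /andP[jk js] /andP[pk ps].
rewrite bl_catr IH // ?addr0; last first.
  by move=> l ls; apply: ns; rewrite inE ls orbT.
by apply: bl_P_P => //; [apply: ns; rewrite inE eqxx|rewrite eq_sym].
Qed.

(** At most one root of each pair, so that distinct members of [s] give orthogonal planes. *)
Fixpoint unpaired (s : seq I) :=
  if s is j :: s' then [&& j \notin s', pt j \notin s' & unpaired s'] else true.

(** Pythagoras: the projection of x_i to the plane of j has squared norm h * eta j * Q j / 3, and
    [L s] is three times what remains of x_i. *)
Lemma bl_L s : (forall k, k \in s -> nT k) -> unpaired s ->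
  bl (L s) (L s) = h * (9 - 3 * \sum_(j <- s) eta j * Q j).
Proof.
elim: s => [|k s IH] ns.
  rewrite /L /bl /= !big_cons !big_nil /=; have [-> _] := Ti; lia.
move=> /and3P[ks ps us]; have nTk : nT k by apply: ns; rewrite inE eqxx.
have ns' l : l \in s -> nT l by move=> ls; apply: ns; rewrite inE ls orbT.
have {}IH := IH ns' us; move: IH; rewrite !L_cat F_cons !(bl_catl, bl_catr) => IH.
have e1 := bl_PP nTk; have e2 := bl_iP nTk; have e3 := bl_P_L nTk ns' ks ps.
rewrite (bl_sym (P k) [:: _]) (bl_sym (F s) (P k)) e3 e1 e2.
have -> : h * (9 - 3 * \sum_(j <- k :: s) eta j * Q j) =
    h * (9 - 3 * \sum_(j <- s) eta j * Q j) - 3 * Q k * (eta k * h).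
  by rewrite big_cons; ring.
by rewrite -IH; ring.
Qed.

Lemma coef_out s k : (forall j, j \in s -> j != k) ->
  (forall j, j \in s -> pt j != k) -> coef (F s) k = 0.
Proof.
elim: s => [|j s IH] sk psk; first by rewrite /coef big_nil.
rewrite F_cons coef_cat IH; last 2 first.
- by move=> l ls; apply: sk; rewrite inE ls orbT.
- by move=> l ls; apply: psk; rewrite inE ls orbT.
rewrite /coef !big_cons big_nil /= (negbTE (sk j _)) ?inE ?eqxx //.
by rewrite (negbTE (psk j _)) ?inE ?eqxx.
Qed.

Lemma coef_head s j : (forall k, k \in j :: s -> nT k) -> unpaired (j :: s) ->
  [/\ coef (L (j :: s)) i = 3, coef (L (j :: s)) j = u j * w j &
      coef (L (j :: s)) (pt j) = v j * w j].
Proof.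
move=> ns /and3P[js ps us]; have nTj : nT j by apply: ns; rewrite inE eqxx.
have ns' l : l \in s -> nT l by move=> ls; apply: ns; rewrite inE ls orbT.
have [pj nTp _ _ _] := ptP nTj.
have ij := negbTE (nT_neq nTj); have ip := negbTE (nT_neq nTp).
have sub k : k \in j :: s -> nT k by apply: ns.
split; rewrite L_cat coef_cat.
- rewrite coef_out; first by rewrite /coef big_cons big_nil /= eqxx.
    by move=> k ks; apply: nT_neq; exact: ns.
  by move=> k /ns /ptP[_ nTpk _ _ _]; exact: nT_neq.
- rewrite F_cons coef_cat coef_out; last 2 first.
  + by move=> k ks; apply: contraNneq js => <-.
  + move=> k ks; apply: contraNneq ps => e.
    by rewrite -e ptK //; exact: ns'.
  by rewrite /coef !big_cons !big_nil /= eqxx (negbTE pj) eq_sym ij !addr0 add0r.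
- rewrite F_cons coef_cat coef_out; last 2 first.
  + by move=> k ks; apply: contraNneq ps => <-.
  + move=> k ks; apply: contraNneq js => e.
    by rewrite -(pt_inj _ nTj e) //; exact: ns'.
  by rewrite /coef !big_cons !big_nil /= eqxx (eq_sym j) (negbTE pj) (eq_sym i) ip !addr0 !add0r.
Qed.

(** The bound 3 makes the norm of [L] at most 0, so [L] is a multiple of [c]; since its coefficient
    at i is 3 = c i, it agrees with [c]. *)
Lemma touch_head s j : (forall k, k \in j :: s -> nT k) -> unpaired (j :: s) ->
  3 <= \sum_(k <- j :: s) eta k * Q k -> u j * w j = c j /\ v j * w j = c j.
Proof.
move=> ns us S3; have nTj : nT j by apply: ns; rewrite inE eqxx.
have supp p : p \in L (j :: s) -> 0 < c p.2.
  rewrite inE => /orP[/eqP ->|]; first by have [_ /= ->] := Ti.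
  case/flattenP => l /mapP[k /ns nTk ->]; have [_ [cp _] _ _ _] := ptP nTk.
  by rewrite !inE => /orP[] /eqP -> //=; have [] := nTk.
have neg : bl (L (j :: s)) (L (j :: s)) <= 0.
  by rewrite bl_L // pmulr_rle0 ?h_gt0 //; lia.
have [e1 e2 e3] := coef_head ns us.
have := null_vector supp neg i j; have := null_vector supp neg i (pt j).
have [_ _ [-> _] _ _] := ptP nTj; have [_ ->] := Ti.
by rewrite e1 e2 e3; lia.
Qed.

Lemma Q_gt0 j : al j <> 0 -> 1 <= Q j.
Proof. by rewrite /Q; move: (al j) (al (pt j)) => x y x0; nia. Qed.

(** Agreement with [c] would read 2 al j - al (pt j) = 2 al (pt j) - al j = 2, so that both values
    of [al] would be 2, beyond [al_bound]. *)
Lemma special_touch_head s j : (forall k, k \in j :: s -> nT k) ->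
  unpaired (j :: s) -> 3 <= \sum_(k <- j :: s) eta k * Q k -> ~ special j.
Proof.
move=> ns us S3 sj; have [] := touch_head ns us S3.
have nTj : nT j by apply: ns; rewrite inE eqxx.
have [_ nTp _ _ _] := ptP nTj; rewrite /u /v /w sj eqxx !mulr1.
have -> : c j = 2.
  by have [cj nt] := nTj; case: (special_c cj sj) => // e; case: nt.
by have := al_bound (nT_neq nTj); have := al_bound (nT_neq nTp); lia.
Qed.

Lemma touch_nT j : j != i -> t i j != 0 -> nT j /\ al j <> 0.
Proof.
move=> ji tj; split; last by move: tj; rewrite alE //; lia.
split; last by move=> Tj; move: tj; rewrite TT_contrib.
rewrite lt_neqAle c_ge0 andbT; apply: contraNneq tj => e.
by rewrite /t -e mulr0.
Qed.

Lemma sum_contrib_out (s : seq I) : uniq (i :: s) ->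
  \sum_(j | j \notin i :: s) t i j = 6 - \sum_(j <- s) t i j.
Proof.
move=> /= /andP[ni us]; have := sum_contrib i; have [_ ->] := Ti.
rewrite (bigID (fun j => j \in s)) /= => e.
apply/eqP; rewrite eq_sym subr_eq (_ : 6 = 2 * 3) // -e addrC.
apply/eqP; congr (_ + _).
  by apply: eq_bigl => j; rewrite inE negb_or.
rewrite big_uniq //=; apply: eq_bigl => j.
by case: (j =P i) => // ->; rewrite (negbTE ni).
Qed.

Lemma contrib_le2 j : j != i -> t i j <= 2.
Proof. by move=> ji; case: (T_contrib Ti ji) => [->|[->|->]]. Qed.

Lemma more_nbrs (s : seq I) : uniq (i :: s) -> \sum_(j <- s) t i j < 6 ->
  exists2 j, j \notin i :: s & t i j = 2.
Proof.
move=> us S6; have := sum_contrib_out us.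
case: (pickP (fun j => (j \notin i :: s) && (t i j == 2))).
  by move=> j /andP[js /eqP tj] _; exists j.
move=> n0 e; exfalso; suff : 6 - \sum_(j <- s) t i j <= 0 by lia.
rewrite -e; apply: sumr_le0 => j js; move: (n0 j); rewrite js /=.
have ji : j != i by apply: contraNneq js => ->; rewrite inE eqxx.
by case: (T_contrib Ti ji) => [->|[->|->]].
Qed.

(** The plane of [k] provides at most 4 of the total 6, so i meets another plane, that of some l. If
    [k] is not special, its weight [eta] is 2 and the two planes weigh too much: at least 3 with l
    special, at least 4 otherwise, where the norm of [L] would be negative. *)
Lemma touch_special k : k != i -> t i k != 0 -> special k.
Proof.
move=> ki tk; have [nTk ak] := touch_nT ki tk.
apply/eqP; apply: contraTT isT => nsk.
have [pk nTp _ _ _] := ptP nTk; have pi := nT_neq nTp.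
have [||l] := @more_nbrs [:: k; pt k].
- by rewrite /= !inE negb_or !(eq_sym i) ki pi eq_sym pk.
- rewrite !big_cons big_nil addr0.
  by move: (contrib_le2 ki) (contrib_le2 pi); lia.
rewrite !inE !negb_or => /and3P[li lk lp] tl.
have tl0 : t i l != 0 by rewrite tl.
have [nTl al0] := touch_nT li tl0.
have ek : eta k = 2 by rewrite /eta (negbTE nsk).
have Qk := Q_gt0 ak; have Ql := Q_gt0 al0.
have ns m : m \in [:: l; k] -> nT m by rewrite !inE => /orP[] /eqP ->.
have us : unpaired [:: l; k].
  rewrite /= !inE lk /= andbT; apply: contraNneq lp => e.
  by rewrite -e ptK.
have SE : \sum_(m <- [:: l; k]) eta m * Q m = eta l * Q l + eta k * Q k.
  by rewrite !big_cons big_nil addr0.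
case: (b l l =P h) => sl.
  have := special_touch_head ns us; rewrite SE => /(_ _ sl) [].
  by rewrite ek /eta sl eqxx; lia.
have := bl_ge0 (L [:: l; k]); rewrite bl_L // pmulr_rge0 ?h_gt0 // SE ek /eta.
by case: eqP => // _; lia.
Qed.

Lemma eta1 k : k != i -> t i k != 0 -> eta k = 1.
Proof. by move=> ki tk; rewrite /eta touch_special ?eqxx. Qed.

Lemma touch3 j k l : j != i -> k != i -> l != i ->
  t i j != 0 -> t i k != 0 -> t i l != 0 -> ~~ unpaired [:: j; k; l].
Proof.
move=> ji ki li tj tk tl; apply/negP => us.
have [nTj aj] := touch_nT ji tj; have [nTk ak] := touch_nT ki tk.
have [nTl al0] := touch_nT li tl.
have ns m : m \in [:: j; k; l] -> nT m by rewrite !inE => /or3P[] /eqP ->.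
apply: (special_touch_head ns us); last exact: touch_special.
rewrite !big_cons big_nil !eta1 //.
by move: (Q_gt0 aj) (Q_gt0 ak) (Q_gt0 al0); lia.
Qed.

(** At most two planes are met, each contribution is at most 2 and the total is 6: one plane gives 2
    + 2, the other 2 + 0. In the graph, two of the three edges at i are matched with each other, and
    the partner of the third does not end at i. *)
Lemma T_structure : exists e k, [/\ nT e /\ nT k, t i e = 2 /\ t i (pt e) = 2,
  t i k = 2 /\ t i (pt k) = 0, k != e /\ k != pt e &
  forall l, l != i -> l != e -> l != pt e -> l != k -> t i l = 0].
Proof.
have [e [ei te tpe]] : exists e, [/\ e != i, t i e = 2 & t i (pt e) = 2].
  case: (pickP (fun e => [&& e != i, t i e == 2 & t i (pt e) == 2])).
    by move=> e /and3P[? /eqP ? /eqP ?]; exists e.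
  move=> n0; exfalso.
  have [||j1] := @more_nbrs [::]; rewrite ?big_nil // !inE => j1i t1.
  have [||j2] := @more_nbrs [:: j1].
  - by rewrite /= !inE eq_sym j1i.
  - by rewrite big_cons big_nil t1.
  rewrite !inE negb_or => /andP[j2i j21] t2.
  have [||j3] := @more_nbrs [:: j1; j2].
  - by rewrite /= !inE negb_or !(eq_sym i) j1i j2i eq_sym j21.
  - by rewrite !big_cons big_nil t1 t2.
  rewrite !inE !negb_or => /and3P[j3i j31 j32] t3.
  have pn j j' : j != i -> t i j = 2 -> t i j' = 2 -> pt j != j'.
    move=> ji tj tj'; apply/negP => /eqP ej.
    by move: (n0 j); rewrite ji tj ej tj' eqxx.
  have := @touch3 j1 j2 j3 j1i j2i j3i; rewrite t1 t2 t3.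
  move=> /(_ isT isT isT)/negP; case.
  by rewrite /= !inE !negb_or !pn // !(eq_sym j1) j21 j31 eq_sym j32.
have te0 : t i e != 0 by rewrite te.
have [nTe ae] := touch_nT ei te0; have [pe nTp _ _ _] := ptP nTe.
have pei := nT_neq nTp.
have [||k] := @more_nbrs [:: e; pt e].
- by rewrite /= !inE negb_or !(eq_sym i) ei pei eq_sym pe.
- by rewrite !big_cons big_nil te tpe.
rewrite !inE !negb_or => /and3P[ki ke kp] tk.
have tk0 : t i k != 0 by rewrite tk.
have [nTk ak] := touch_nT ki tk0; have [pk nTpk _ _ _] := ptP nTk.
have pki := nT_neq nTpk.
have out l : l != i -> l != e -> l != pt e -> l != k -> l != pt k -> t i l = 0.
  move=> li le lpe lk lpk; apply/eqP; apply: contraTT isT => tl.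
  have /negP := @touch3 e k l ei ki li te0 tk0 tl; case.
  by rewrite /= !inE !negb_or !(eq_sym e) !(eq_sym (pt e)) ke le kp lpe eq_sym lk eq_sym lpk.
have pke : pt k != e by apply: contraNneq kp => <-; rewrite ptK.
have pkpe : pt k != pt e by apply: contraNneq ke => /(pt_inj nTk nTe)->.
have us : uniq [:: i; e; pt e; k; pt k].
  rewrite /= !inE !negb_or !(eq_sym i) ei pei ki pki !(eq_sym e) pe ke pke.
  by rewrite !(eq_sym (pt e)) kp pkpe eq_sym pk.
have := sum_contrib_out us; rewrite big1; last first.
  by move=> l; rewrite !inE !negb_or => /and5P[? ? ? ? ?]; exact: out.
rewrite !big_cons big_nil te tpe tk => S0.
have tpk : t i (pt k) = 0 by clear -S0; lia.
exists e, k; split=> // l li le lpe lk.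
by case: (l =P pt k) => [->//|/eqP lpk]; exact: out.
Qed.
Lemma T_nonneg l : l != i -> 0 <= t i l.
Proof.
move=> li; have [e [k [_ [te tpe] [tk _] _ H]]] := T_structure.
case: (l =P e) => [->|/eqP le]; first by rewrite te.
case: (l =P pt e) => [->|/eqP lpe]; first by rewrite tpe.
case: (l =P k) => [->|/eqP lk]; first by rewrite tk.
by rewrite H.
Qed.
End Touch.

(** * The cubic graph and its closed trail *)

Lemma N_empty k : ~ N k.
Proof.
move=> Nk; have [nk ck] := Nk; have [i [ik ti]] := negnbr ck.
have [Ti tik _ _] := N_negnbr Nk ik ti; apply: nk.
by apply: (touch_special Ti); rewrite ?tik // eq_sym.
Qed.

Lemma nT_D j : nT j -> D j.
Proof. by move=> [cj nTj]; case: (TDN cj) => // /N_empty. Qed.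

Lemma T_exists : exists i, T i.
Proof.
have [i ci] := c_neq0; case: (TDN ci) => [Ti|Di|/N_empty//]; first by exists i.
have [j [ji tj]] := negnbr ci; exists j.
by have [] := D_neg Di ji tj.
Qed.

Lemma TD_form i j : T i -> nT j -> t i j = 2 -> 2 * b i j = - h.
Proof.
move=> [si ci] nTj e; have [sj cj] := nT_D nTj.
move: e; rewrite -aE si /t cj => e; have -> : a i j = -1; lia.
Qed.

Lemma TD_form0 i j : nT j -> t i j = 0 -> b i j = 0.
Proof. by move=> [cj _]; apply: contrib0_b. Qed.

Lemma TT_form i j : T i -> T j -> j != i -> b i j = 0.
Proof.
by move=> Ti Tj ji; apply: contrib0_b; [have [_ ->] := Tj|exact: TT_contrib].
Qed.

(** An edge has exactly two ends: the total 4 at [j] is made of -2 from its partner and of 3 from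
    each end. *)
Lemma D_neighbour i j : T i -> nT j -> t i j = 2 ->
  exists i', [/\ T i', i' != i, t i' j = 2 &
    forall l, T l -> l != i -> l != i' -> t l j = 0].
Proof.
move=> Ti nTj tij; have Dj := nT_D nTj; have [sj cj] := Dj.
have ji := nT_neq Ti nTj.
have tE l : T l -> 3 * t l j = 2 * t j l.
  by move=> [sl cl]; rewrite /t cj cl (special_cartan sl sj); lia.
have tji : t j i = 3 by move: (tE i Ti); lia.
have [pj nTp [cp bp] bjp H] := ptP nTj; have [sp cp'] := nT_D nTp.
have tjp : t j (pt j) = -2.
  have : a j (pt j) * h = 1 * h by rewrite -{1}sj aE bjp sj mul1r.
  by move/mulIf => e; rewrite /t e ?gt_eqF ?h_gt0 ?cp' //; lia.
have pi := nT_neq Ti nTp; have ij : i != j by rewrite eq_sym.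
have cj0 : 0 < c j by rewrite cj.
have tpos l : l != j -> 0 < t j l -> T l /\ t j l = 3 by exact: D_neg.
have tge l : l != j -> l != pt j -> 0 <= t j l.
  move=> lj lp; rewrite leNgt; apply/negP => tl.
  have [cl _ _ tl'] := contrib_neg cj0 tl; case: (TDN cl) => [Tl|Dl|/N_empty//].
    by have := T_nonneg Tl (nT_neq Tl nTj); lia.
  have nTl : nT l by split=> // -[_]; have [_ ->] := Dl.
  move: tl (aE j l); rewrite /t (H l nTl lj lp) sj mulr0 => tl /eqP.
  by rewrite mulf_eq0 (gt_eqF h_gt0) orbF => /eqP e; rewrite e in tl; lia.
have S3 : \sum_(l | [&& l != j, l != i & l != pt j]) t j l = 3.
  have := sum_contrib j; rewrite (bigD1 i) //= (bigD1 (pt j)) /=; last by rewrite pj.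
  rewrite tji tjp cj (eq_bigl (fun l => [&& l != j, l != i & l != pt j])).
    by set S := \sum_(l | _) _; clearbody S; clear; lia.
  by move=> l; rewrite andbA.
have [i' /and4P[ij' ii' ip' ti']] : exists i',
    [&& i' != j, i' != i, i' != pt j & 0 < t j i'].
  case: (pickP (fun l => [&& l != j, l != i, l != pt j & 0 < t j l])) => [l|n0].
    by exists l.
  suff : 3 <= 0 :> int by [].
  rewrite -S3; apply: sumr_le0 => l /and3P[lj li lp].
  by move: (n0 l); rewrite lj li lp /= ltNge => /negbFE.
have [Ti' tji'] := tpos i' ij' ti'.
exists i'; split=> //; first by have := tE i' Ti'; lia.
move=> l Tl li li'; have jl := nT_neq Tl nTj; have pl := nT_neq Tl nTp.
have lj : l != j by rewrite eq_sym.
have lp : l != pt j by rewrite eq_sym.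
have S0 : \sum_(l | [&& l != j, l != i & l != pt j] && (l != i')) t j l = 0.
  move: S3; rewrite (bigD1 i') /=; last by rewrite ij' ii'.
  by rewrite tji'; set S := \sum_(l | _) _; clearbody S; clear; lia.
have e : t j l = 0.
  have := psumr_eq0P _ S0; apply; last by rewrite lj li lp li'.
  by move=> m /andP[/and3P[? _ ?] _]; exact: tge.
move: (tE l Tl); rewrite e; set x := t l j; clearbody x; clear; lia.
Qed.

Lemma D_norm j : nT j -> b j j = h.
Proof. by move=> /nT_D[]. Qed.

Let blv X l := bl X [:: (1, l)].

Section Pairing.
Variables (i e k : I).
Hypothesis Ti : T i.
Hypothesis nTe : nT e.
Hypothesis nTk : nT k.
Hypotheses (te : t i e = 2) (tpe : t i (pt e) = 2).
Hypotheses (tk : t i k = 2) (tpk : t i (pt k) = 0).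
Hypotheses (ke : k != e) (kpe : k != pt e).
Hypothesis tout : forall l, l != i -> l != e -> l != pt e -> l != k -> t i l = 0.

(* Three times the component of x_i orthogonal to all the roots outside T. *)
Let W : seq (int * I) := [:: (3, i); (1, e); (1, pt e); (2, k); (-1, pt k)].

Lemma pairing_nT l : nT l -> blv W l = 0.
Proof.
move=> nTl; have li := nT_neq Ti nTl.
have [pe nTpe [_ be] bpe He] := ptP nTe; have [pk nTpk [_ bk] bpk Hk] := ptP nTk.
have [_ _ _ _ Hpe] := ptP nTpe; have [_ _ _ _ Hpk] := ptP nTpk.
rewrite (ptK nTe) in Hpe; rewrite (ptK nTk) in Hpk.
have be0 := D_norm nTe; have bk0 := D_norm nTk.
have pke : pt k != e by apply: contraNneq kpe => <-; rewrite ptK.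
have pkpe : pt k != pt e by apply: contraNneq ke => /(pt_inj nTk nTe)->.
have Fe := TD_form Ti nTe te; have Fpe := TD_form Ti nTpe tpe.
have Fk := TD_form Ti nTk tk; have Fpk := TD_form0 nTpk tpk.
rewrite /blv /bl !big_cons !big_nil /= !addr0.
case: (l =P e) => [->|/eqP le].
  rewrite (bC (pt e) e) (Hk e) // 1?eq_sym // (Hpk e) // 1?eq_sym //.
  by clear -Fe bpe be0; lia.
case: (l =P pt e) => [->|/eqP lpe].
  rewrite (Hk (pt e)) // 1?eq_sym // (Hpk (pt e)) // 1?eq_sym //.
  by clear -Fpe bpe be be0; lia.
case: (l =P k) => [->|/eqP lk].
  by rewrite (bC (pt k) k) (He k) // (Hpe k) //; clear -Fk bpk bk0; lia.
case: (l =P pt k) => [->|/eqP lpk].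
  by rewrite (He (pt k)) // (Hpe (pt k)) // Fpk; clear -bpk bk bk0; lia.
by rewrite (He l) // (Hpe l) // (Hk l) // (Hpk l) // (TD_form0 nTl (tout li le lpe lk)) !mulr0.
Qed.
Lemma bl_cons X p l L : bl X ((p, l) :: L) = p * blv X l + bl X L.
Proof.
rewrite -cat1s bl_catr; congr (_ + _); rewrite /blv /bl mulr_sumr.
by apply: eq_bigr => q _; rewrite !big_cons !big_nil /=; ring.
Qed.

Lemma pairing_T i' : blv W i' =
  3 * b i i' + b e i' + b (pt e) i' + 2 * b k i' - b (pt k) i'.
Proof. by rewrite /blv /bl !big_cons !big_nil /=; ring. Qed.

Lemma pairing_self : bl W W = 3 * h.
Proof.
have [_ nTpe _ _ _] := ptP nTe; have [_ nTpk _ _ _] := ptP nTk.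
rewrite {2}/W !bl_cons (pairing_nT nTe) (pairing_nT nTpe) (pairing_nT nTk).
rewrite (pairing_nT nTpk) bl_nil pairing_T.
have Fe := TD_form Ti nTe te; have Fpe := TD_form Ti nTpe tpe.
have Fk := TD_form Ti nTk tk; have Fpk := TD_form0 nTpk tpk.
rewrite (bC e) (bC (pt e)) (bC k) (bC (pt k)) Fpk; have [-> _] := Ti.
by clear -Fe Fpe Fk; lia.
Qed.
End Pairing.

Lemma TD_form_le0 i j : T i -> nT j -> b i j <= 0.
Proof.
move=> Ti nTj; case: (t i j =P 0) => [/(TD_form0 nTj)->//|/eqP tj].
have tp := T_nonneg Ti (nT_neq Ti nTj).
have tj2 : t i j = 2.
  by case: (T_contrib Ti (nT_neq Ti nTj)) => [//|[e|e]]; rewrite e in tp tj.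
by have := TD_form Ti nTj tj2; have := h_gt0; clear; lia.
Qed.

(** In the graph: [k] is the edge at [i] that is not matched with another edge at [i]. *)
Definition half_of i k := exists e, [/\ nT e /\ nT k, t i e = 2 /\ t i (pt e) = 2,
  t i k = 2 /\ t i (pt k) = 0, k != e /\ k != pt e &
  forall l, l != i -> l != e -> l != pt e -> l != k -> t i l = 0].

(** The vectors W and W' of two such ends have norm 3 h and product at most - 3 h, so that W + W' is
    null. But its coefficient at [pt k] is -2, while that at i is 3. *)
Lemma half_not_shared i i' k : T i -> T i' -> i' != i ->
  half_of i k -> half_of i' k -> False.
Proof.
move=> Ti Ti' ii' [e [[nTe nTk] [te tpe] [tk tpk] [ke kpe] out]].
move=> [e' [[nTe' _] [te' tpe'] [tk' tpk'] [ke' kpe'] out']].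
pose W : seq (int * I) := [:: (3, i); (1, e); (1, pt e); (2, k); (-1, pt k)].
pose W' : seq (int * I) := [:: (3, i'); (1, e'); (1, pt e'); (2, k); (-1, pt k)].
have [pe nTpe _ _ _] := ptP nTe; have [pk nTpk [cpk _] _ _] := ptP nTk.
have [pe' nTpe' _ _ _] := ptP nTe'.
have e1 : bl W W = 3 * h by exact: pairing_self.
have e2 : bl W' W' = 3 * h by exact: pairing_self.
have e3 : bl W W' <= - (3 * h).
  have pn l : nT l -> blv W l = 0 by exact: pairing_nT.
  rewrite /W' !bl_cons !(pn e', pn (pt e'), pn k, pn (pt k)) // bl_nil.
  have -> : blv W i' = 3 * b i i' + b e i' + b (pt e) i' + 2 * b k i' - b (pt k) i'.
    exact: pairing_T.
  have Fe := TD_form_le0 Ti' nTe; have Fpe := TD_form_le0 Ti' nTpe.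
  have Fk := TD_form Ti' nTk tk'; have Fpk := TD_form0 nTpk tpk'.
  rewrite (TT_form Ti Ti' ii') (bC e) (bC (pt e)) (bC k) (bC (pt k)) Fpk.
  by clear -Fe Fpe Fk; lia.
have neg : bl (W ++ W') (W ++ W') <= 0.
  by rewrite !bl_catl !bl_catr (bl_sym W' W) e1 e2; clear -e3; lia.
have supp p : p \in W ++ W' -> 0 < c p.2.
  have ci : 0 < c i by have [_ ->] := Ti.
  have ci' : 0 < c i' by have [_ ->] := Ti'.
  have [? _] := nTe; have [? _] := nTpe; have [? _] := nTe'.
  have [? _] := nTpe'; have [? _] := nTk; have [? _] := nTpk.
  by rewrite mem_cat !inE => /orP[] /or4P[|||/orP[]] /eqP ->.
have := null_vector supp neg i (pt k); rewrite cpk.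
have [_ ->] := nT_D nTk; have [_ ->] := Ti.
have ne x : nT x -> (x == i) = false by move=> nTx; exact/negbTE/nT_neq.
have ne' x : nT x -> (i' == x) = false.
  by move=> nTx; rewrite eq_sym; exact/negbTE/nT_neq.
have ne1 x : nT x -> (i == x) = false by move=> nTx; rewrite eq_sym ne.
have pke : (e == pt k) = false by apply/negbTE; apply: contraNneq kpe => ->; rewrite ptK.
have pke' : (e' == pt k) = false by apply/negbTE; apply: contraNneq kpe' => ->; rewrite ptK.
have pkpe : (pt e == pt k) = false.
  by apply/negbTE; apply: contraNneq ke => /(pt_inj nTe nTk)->.
have pkpe' : (pt e' == pt k) = false.
  by apply/negbTE; apply: contraNneq ke' => /(pt_inj nTe' nTk)->.
have kpk : (k == pt k) = false by rewrite eq_sym; exact: negbTE.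
rewrite /coef !big_cons !big_nil /= !eqxx (negbTE ii') !ne // !ne1 // !ne' //.
by rewrite pke pke' pkpe pkpe' kpk.
Qed.

Lemma next_exists i : exists k i', T i -> [/\ half_of i k, T i', i' != i, t i' k = 2 &
  forall l, T l -> l != i -> l != i' -> t l k = 0].
Proof.
case: (b i i =P h) => [si|ns]; last by exists i, i => -[].
case: (c i =P 3) => [ci|nc]; last by exists i, i => -[].
have Ti : T i by [].
have [e [k H]] := T_structure Ti; have [[_ nTk] _ [tk _] _ _] := H.
have [i' [? ? ? ?]] := D_neighbour Ti nTk tk.
by exists k, i' => _; split=> //; exists e.
Qed.

Lemma half_full i k l : T i -> half_of i k -> nT l -> l <> k -> t i l = 2 ->
  t i (pt l) = 2.
Proof.
move=> Ti [e [[nTe nTk] [te tpe] [tk tpk] _ out]] nTl lk tl.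
case: (l =P e) => [->//|/eqP le]; case: (l =P pt e) => [->|/eqP lpe].
  by rewrite ptK.
by move: tl; rewrite out //; [exact: (nT_neq Ti)|exact/eqP].
Qed.

(* A closed trail through the vertices of T, leaving each vertex by its unpaired
   edge, is an affine cycle of simply laced roots, whose sum is null. *)
Lemma no_minimal_circuit : False.
Proof.
have [f /fin_all_exists[g H]] := fin_all_exists next_exists.
pose Ts := [set i | (b i i == h) && (c i == 3)].
have TsP i : reflect (T i) (i \in Ts).
  rewrite inE; apply: (iffP andP) => -[]; first by move=> /eqP ? /eqP.
  by move=> -> ->; rewrite !eqxx.
(* A smallest nonempty set stable under [g] is permuted by [g]; it carries the closed trail. *)
pose closed (O : {set I}) := [&& O != set0, O \subset Ts & g @: O \subset O].
have [i0 Ti0] := T_exists.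
have cTs : closed Ts.
  apply/and3P; split=> //; first by apply/set0Pn; exists i0; exact/TsP.
  by apply/subsetP => _ /imsetP[i /TsP Ti ->]; apply/TsP; have [] := H i Ti.
case: (@arg_minnP _ Ts closed (fun O => #|O|) cTs) => O /and3P[On0 OT gO] Omin.
have cgO : closed (g @: O).
  apply/and3P; split; last exact: imsetS.
    by have [x xO] := set0Pn _ On0; apply/set0Pn; exists (g x); exact: imset_f.
  exact: subset_trans OT.
have cardO : #|g @: O| = #|O|.
  by apply/eqP; rewrite eqn_leq leq_imset_card Omin.
have ginj : {in O &, injective g} by apply/imset_injP/eqP.
have gOE : g @: O = O by apply/eqP; rewrite eqEcard gO cardO leqnn.
have OTi i : i \in O -> T i by move=> iO; apply/TsP; exact: (subsetP OT).
have gO' i : i \in O -> g i \in O by move=> iO; apply: (subsetP gO); exact: imset_f.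
have nTf i : i \in O -> nT (f i).
  by move=> /OTi /(H i)[[e [[]]]].
have tf i : i \in O -> t i (f i) = 2 /\ t i (pt (f i)) = 0.
  by move=> /OTi /(H i)[[e [_ _ []]]].
have finj i i' : i \in O -> i' \in O -> f i = f i' -> i = i'.
  move=> iO i'O ef; apply/eqP; apply: contraTT isT => ii'.
  have [hi _ _ _ _] := H i (OTi i iO); have [hi' _ _ _ _] := H i' (OTi i' i'O).
  by case: (@half_not_shared i i' (f i)) => //; rewrite ?ef ?[i' == i]eq_sym //; exact: OTi.
pose V : seq (int * I) := [seq (1, i) | i <- enum O] ++ [seq (1, f i) | i <- enum O].
have blV X : bl X V = \sum_(i in O) blv X i + \sum_(i in O) blv X (f i).
  rewrite bl_catr; have E (F : I -> I) : bl X [seq (1, F i) | i <- enum O] =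
      \sum_(i in O) blv X (F i).
    rewrite -[RHS]big_enum /=; elim: (enum O) => [|x s IH] /=.
      by rewrite bl_nil big_nil.
    by rewrite bl_cons IH big_cons mul1r.
  by rewrite (E id) E.
have bl11 i j : blv [:: (1, i)] j = b i j.
  by rewrite /blv /bl !big_cons !big_nil /= mulr1 mul1r !addr0.
have nTpf i : i \in O -> nT (pt (f i)) by move=> /nTf /ptP[].
have Vi i : i \in O -> blv V i = 0.
  move=> iO; have Ti := OTi i iO; rewrite /blv bl_sym blV.
  under eq_bigr do rewrite bl11; under [X in _ + X]eq_bigr do rewrite bl11.
  have [j jO ej] : exists2 j, j \in O & g j = i.
    by move: iO; rewrite -{1}gOE => /imsetP[j jO ->]; exists j.
  have [hj Tgj gjj tgj outj] := H j (OTi j jO).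
  have ji : j != i by rewrite -ej eq_sym.
  rewrite (bigD1 i) //= [X in b i i + X]big1 ?addr0; last first.
    by move=> k /andP[kO ki]; apply: TT_form => //; exact: OTi.
  rewrite (bigD1 i) //= (bigD1 j) /=; last by rewrite jO.
  rewrite big1 ?addr0; last first.
    move=> k /andP[/andP[kO ki] kj]; apply: (TD_form0 (nTf k kO)).
    have [_ _ _ _ out] := H k (OTi k kO).
    apply: out => //; first by rewrite eq_sym.
    by apply: contraNneq kj => e; apply/eqP/ginj; rewrite // ej -e.
  have F1 := TD_form Ti (nTf i iO) (tf i iO).1.
  have F2 : 2 * b i (f j) = - h by apply: TD_form => //; [exact: nTf|rewrite -ej].
  have [-> _] := Ti; by clear -F1 F2; lia.
have Vf i : i \in O -> blv V (f i) = 0.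
  move=> iO; have Ti := OTi i iO; have nTfi := nTf i iO.
  have [hi Tgi gii tgi out] := H i Ti; have giO := gO' i iO.
  rewrite /blv bl_sym blV.
  under eq_bigr do rewrite bl11; under [X in _ + X]eq_bigr do rewrite bl11.
  rewrite (bigD1 i) //= (bigD1 (g i)) /=; last by rewrite giO.
  rewrite big1 ?addr0; last first.
    move=> k /andP[/andP[kO ki] kg]; rewrite bC; apply: (TD_form0 nTfi).
    by apply: out => //; exact: OTi.
  rewrite (bigD1 i) //= big1 ?addr0; last first.
    move=> k /andP[kO ki]; have [_ _ _ _ Hf] := ptP nTfi.
    apply: Hf; first exact: nTf.
      by apply: contraNneq ki => e; rewrite (finj _ _ kO iO e).
    (* Suppose f k is the partner of f i. At g i the edge f i is not the unmatched one, so f k ends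
       there too, and g i is k or g k. The first makes f k matched at k, the second gives i = k. *)
    apply/eqP => ef; have Tk := OTi k kO.
    have fne : f i <> f (g i).
      by move=> e; move: gii; rewrite -(finj _ _ iO giO e) eqxx.
    have tgp : t (g i) (pt (f i)) = 2.
      by have [hg _ _ _ _] := H (g i) Tgi; exact: (half_full Tgi hg).
    rewrite -ef in tgp; have [_ _ _ _ outk] := H k Tk.
    case: (g i =P k) => [ek|/eqP gk].
      by have := (tf k kO).2; rewrite ef ptK // -{1}ek tgi.
    case: (g i =P g k) => [/ginj ek|/eqP gg]; first by rewrite ek ?eqxx in ki.
    by move: tgp; rewrite outk.
  have F1 := TD_form Ti nTfi (tf i iO).1; have F2 := TD_form Tgi nTfi tgi.
  by rewrite (bC (f i) i) (bC (f i) (g i)) (D_norm nTfi); clear -F1 F2; lia.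
have V0 : bl V V <= 0.
  by rewrite blV (big1 _ _ _ Vi) (big1 _ _ _ Vf).
have supp p : p \in V -> 0 < c p.2.
  rewrite mem_cat => /orP[] /mapP[i]; rewrite mem_enum => iO -> /=.
    by have [_ ->] := OTi i iO.
  by have [] := nTf i iO.
have [i iO] := set0Pn _ On0; have Ti := OTi i iO; have nTfi := nTf i iO.
(* The null vector has coefficient 1 both at the vertex i and at the edge f i, where [c] has 3 and
   2. *)
have := null_vector supp V0 i (f i).
have [_ ->] := Ti; have [_ ->] := nT_D nTfi.
have coefE k : coef V k = \sum_(i in O) ((i == k)%:R + (f i == k)%:R).
  rewrite coef_cat big_split /= /coef !big_map !big_enum /=.
  by congr (_ + _); apply: eq_bigr => j _; case: eqP.
have -> : coef V i = 1.
  rewrite coefE (bigD1 i) //= eqxx (negbTE (nT_neq Ti nTfi)) addr0 big1 ?addr0 //.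
  move=> j /andP[jO ji]; rewrite (negbTE ji) add0r.
  by rewrite (negbTE (nT_neq Ti (nTf j jO))).
have -> : coef V (f i) = 1.
  rewrite coefE (bigD1 i) //= eqxx eq_sym (negbTE (nT_neq Ti nTfi)) add0r.
  rewrite big1 ?addr0 // => j /andP[jO ji].
  rewrite eq_sym (negbTE (nT_neq (OTi j jO) nTfi)) add0r.
  by case: eqP => // e; rewrite (finj _ _ jO iO e) eqxx in ji.
by [].
Qed.
End Partner.

Lemma minimal_circuit_absurd : False.
Proof.
have [pt ptP] := fin_all_exists partner_exists.
exact: no_minimal_circuit ptP.
Qed.
End MinimalCircuit.

(** * Circuits of roots *)

Lemma mul_eq4 (a a' : int) : a * a' = 4 ->
  a = 1 \/ a = -1 \/ a = 2 \/ a = -2 \/ a = 4 \/ a = -4.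
Proof.
move=> e; have : (`|a| %| 4)%N.
  by apply/dvdnP; exists `|a'|%N; rewrite -abszM mulrC e.
move/dvdn_leq => /(_ isT) a4.
have a0 : a <> 0 by move=> a0; rewrite a0 mul0r in e.
have a3 : a <> 3 by move=> a3; rewrite a3 in e; lia.
have a3' : a <> -3 by move=> a3'; rewrite a3' in e; lia.
by clear -a0 a3 a3' a4; lia.
Qed.

Lemma mul_eq3 (a a' : int) : a * a' = 3 -> a < 0 ->
  a = -1 /\ a' = -3 \/ a = -3 /\ a' = -1.
Proof.
move=> e a0; have : (`|a| %| 3)%N.
  by apply/dvdnP; exists `|a'|%N; rewrite -abszM mulrC e.
rewrite dvdn_divisors // !inE => /orP[] /eqP a3.
  have ea : a = -1 by clear -a0 a3; lia.
  by left; rewrite ea in e *; clear -e; lia.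
have ea : a = -3 by clear -a0 a3; lia.
by right; rewrite ea in e *; clear -e; lia.
Qed.

Lemma dvdz_eq (a b : int) : 0 < a -> 0 < b -> (a %| b)%Z -> (b %| a)%Z -> a = b.
Proof.
rewrite !dvdzE => a0 b0 ab ba.
suff /eqP : `|a|%N == `|b|%N by lia.
by rewrite eqn_dvd ab ba.
Qed.

Section Roots.
Variables (V : lmodType int) (B : V -> V -> int) (root : V -> Prop).

(** The Cartan integer <u, v^vee>; the division is exact when both vectors are roots. *)
Definition cart u v : int := (2 * B u v %/ B v v)%Z.
Definition refl v u := u - cart u v *: v.

Record crystallographic : Prop := Crystallographic {
  form_sym : forall u v, B u v = B v u;
  form_linear : forall k u v w, B (k *: u + v) w = k * B u w + B v w;
  form_gt0 : forall u, u != 0 -> 0 < B u u;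
  root_neq0 : forall v, root v -> v != 0;
  root_integral : forall u v, root u -> root v -> (B v v %| 2 * B u v)%Z;
  root_refl : forall u v, root u -> root v -> root (refl v u);
  root_reduced : forall v, root v -> ~ root (2 *: v)
}.

Hypothesis cr : crystallographic.

Lemma formC u v : B u v = B v u. Proof. exact: (form_sym cr). Qed.

Lemma form0l v : B 0 v = 0.
Proof.
have := form_linear cr 1 0 0 v; rewrite scaler0 addr0 mul1r => /eqP.
by rewrite -[X in X == _]addr0 (inj_eq (addrI _)) eq_sym => /eqP.
Qed.

Lemma formDl u v w : B (u + v) w = B u w + B v w.
Proof. by rewrite -[u]scale1r (form_linear cr) scale1r mul1r. Qed.

Lemma formZl k u w : B (k *: u) w = k * B u w.
Proof. by rewrite -[k *: u]addr0 (form_linear cr) form0l addr0. Qed.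

Lemma formNl u w : B (- u) w = - B u w.
Proof. by rewrite -scaleN1r formZl mulN1r. Qed.

Lemma formDr u v w : B w (u + v) = B w u + B w v.
Proof. by rewrite !(formC w) formDl. Qed.

Lemma formZr k u w : B w (k *: u) = k * B w u.
Proof. by rewrite !(formC w) formZl. Qed.

Lemma formNr u w : B w (- u) = - B w u.
Proof. by rewrite !(formC w) formNl. Qed.

Definition formE := (formDl, formZl, formNl, formDr, formZr, formNr).

Lemma form_suml (J : Type) (r : seq J) (P : pred J) (F : J -> V) w :
  B (\sum_(j <- r | P j) F j) w = \sum_(j <- r | P j) B (F j) w.
Proof. by apply: (big_morph (B^~ w)) => [u v|]; rewrite ?formDl ?form0l. Qed.

Lemma form_ge0 u : 0 <= B u u.
Proof.
have [->|u0] := eqVneq u 0; first by rewrite form0l.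
exact/ltW/(form_gt0 cr).
Qed.

Lemma form_eq0 u : B u u <= 0 -> u = 0.
Proof.
by move=> Bu; apply/eqP; apply: contraTT Bu => u0; rewrite -ltNge (form_gt0 cr).
Qed.

Lemma root_form_gt0 v : root v -> 0 < B v v.
Proof. by move=> /(root_neq0 cr); exact: form_gt0. Qed.

Lemma cartE u v : root u -> root v -> cart u v * B v v = 2 * B u v.
Proof. by move=> ru rv; rewrite /cart divzK //; exact: root_integral. Qed.

Lemma cart_self v : root v -> cart v v = 2.
Proof. by move=> rv; have := cartE rv rv; have := root_form_gt0 rv; nia. Qed.

Lemma root_opp v : root v -> root (- v).
Proof.
move=> rv; have := root_refl cr rv rv.
by rewrite /refl cart_self // -{1}[v]scale1r -scalerBl scaleN1r.
Qed.

Lemma refl_form u v : root u -> root v -> B (refl v u) (refl v u) = B u u.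
Proof.
move=> ru rv; rewrite /refl !formE (formC v u).
have := cartE ru rv; set a := cart u v => e.
rewrite -(subrK (2 * a * B u v) (B u u)) -[in LHS]mulrA.
suff : a * (a * B v v) = 2 * (a * B u v) by clear; lia.
by rewrite e; ring.
Qed.

Lemma reflK u v : root u -> root v -> refl v (refl v u) = u.
Proof.
move=> ru rv; rewrite {1}/refl; suff -> : cart (refl v u) v = - cart u v.
  by rewrite scaleNr opprK /refl subrK.
apply: (@mulIf _ (B v v)); first by rewrite gt_eqF ?root_form_gt0.
rewrite mulNr !cartE //; last exact: root_refl.
have := cartE ru rv; rewrite /refl !formE; lia.
Qed.

Lemma double_eq0 (u : V) : 2 *: u = 0 -> u = 0.
Proof.
move=> u0; apply: form_eq0; have := form0l u.
by rewrite -u0 formZl; lia.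
Qed.

(** The boundary case of Cauchy-Schwarz: |2 u - a v|^2 = |u|^2 (4 - a a'), where a and a' are the
    two Cartan integers. *)
Lemma cart_prod_ge4 u v : root u -> root v -> 3 < cart u v * cart v u ->
  2 *: u = cart u v *: v /\ cart u v * cart v u = 4.
Proof.
move=> ru rv a3; have eu := cartE ru rv; have ev := cartE rv ru.
have qu := root_form_gt0 ru; rewrite (formC v u) in ev; move: a3 eu ev.
move: (cart u v) (cart v u) => a a' a3 eu ev.
have nE : B (2 *: u - a *: v) (2 *: u - a *: v) = B u u * (4 - a * a').
  rewrite !formE (formC v u).
  have e1 : a * (a * B v v) = a * (2 * B u v) by rewrite eu.
  have e2 : a * (a' * B u u) = a * (2 * B u v) by rewrite ev.
  by move: e1 e2; clear; lia.
have n0 : 2 *: u - a *: v = 0.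
  by apply: form_eq0; rewrite nE; rewrite pmulr_rle0 //; clear -a3; lia.
split; first by apply/eqP; rewrite -subr_eq0 n0.
move: nE; rewrite n0 form0l => /esym/eqP; rewrite mulf_eq0 (gt_eqF qu) orFb subr_eq0.
by move=> /eqP <-.
Qed.

Lemma parallel_roots u v : root u -> root v -> 3 < cart u v * cart v u ->
  u = v \/ u = - v.
Proof.
move=> ru rv a3; have [eu a4] := cart_prod_ge4 ru rv a3.
rewrite mulrC in a3; have [ev _] := cart_prod_ge4 rv ru a3.
move: eu ev a4; move: {a3}(cart u v) (cart v u) => a a' eu ev a4.
have no u' v' : root u' -> root v' -> 2 *: u' = 1 *: v' \/ 2 *: u' = -1 *: v' -> False.
  move=> ru' rv'; rewrite scale1r scaleN1r => -[] e.
    by apply: (root_reduced cr ru'); rewrite e.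
  by apply: (root_reduced cr ru'); rewrite e; exact: root_opp.
have : [\/ a = 1 \/ a = -1, a' = 1 \/ a' = -1 | a = 2 \/ a = -2].
  have [e|[e|[e|[e|[e|e]]]]] : a = 1 \/ a = -1 \/ a = 2 \/ a = -2 \/ a = 4 \/ a = -4.
    exact: mul_eq4 a4.
  - by apply: Or31; left.
  - by apply: Or31; right.
  - by apply: Or33; left.
  - by apply: Or33; right.
  - by apply: Or32; rewrite e in a4; clear -a4; lia.
  - by apply: Or32; rewrite e in a4; clear -a4; lia.
case=> [e|e|[] e].
- by case: (no u v ru rv); case: e eu => <-; [left|right].
- by case: (no v u rv ru); case: e ev => <-; [left|right].
- left; apply/eqP; rewrite -subr_eq0; apply/eqP/double_eq0.
  by rewrite scalerBr eu e subrr.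
right; apply/eqP; rewrite -subr_eq0 opprK; apply/eqP/double_eq0.
by rewrite scalerDr eu e -scalerDl addNr scale0r.
Qed.

(** * Circuits and their good indices *)

Section Circuit.
Variable I : finType.
Implicit Types (x : I -> V) (c : I -> int) (L : seq (int * I)).

Definition comb_coef L k : int := \sum_(p <- L) (if p.2 == k then p.1 else 0).

Record circuit x c : Prop := Circuit {
  circuit_root : forall i, root (x i);
  circuit_ge0 : forall i, 0 <= c i;
  circuit_neq0 : exists i, 0 < c i;
  circuit_rel : \sum_i c i *: x i = 0;
  circuit_uniq : forall d : I -> int, (forall i, c i = 0 -> d i = 0) ->
    \sum_i d i *: x i = 0 -> forall i j, d i * c j = d j * c i
}.

(* The gcds of the coefficients of the relations between the roots and between the coroots. *)
Record normalized x c (h : int) : Prop := Normalized {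
  normalized1 : forall d : int, (forall i, (d %| c i)%Z) -> (d %| 1)%Z;
  normalized_gt0 : 0 < h;
  normalized_dvd : forall i, (h %| B (x i) (x i) * c i)%Z;
  normalized_gcd : forall d : int, (forall i, (d %| B (x i) (x i) * c i)%Z) -> (d %| h)%Z
}.

Lemma comb_coefE x L :
  \sum_k comb_coef L k *: x k = \sum_(p <- L) p.1 *: x p.2.
Proof.
under eq_bigr do rewrite scaler_suml; rewrite exchange_big /=.
apply: eq_bigr => p _; rewrite (bigD1 p.2) //= eqxx big1 ?addr0 // => k kp.
by rewrite eq_sym (negbTE kp) scale0r.
Qed.

Lemma comb_form x L L' :
  B (\sum_(p <- L) p.1 *: x p.2) (\sum_(q <- L') q.1 *: x q.2) =
  \sum_(p <- L) \sum_(q <- L') p.1 * q.1 * B (x p.2) (x q.2).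
Proof.
rewrite form_suml; apply: eq_bigr => p _; rewrite formC form_suml.
by apply: eq_bigr => q _; rewrite !formE formC; ring.
Qed.

Lemma circuit_comb x c L : circuit x c -> (forall p, p \in L -> 0 < c p.2) ->
  \sum_(p <- L) p.1 *: x p.2 = 0 ->
  forall i j, comb_coef L i * c j = comb_coef L j * c i.
Proof.
move=> C supp L0; apply: (circuit_uniq C); last by rewrite comb_coefE.
move=> i ci; rewrite /comb_coef big_seq big1 // => p /supp; case: eqP => // ->.
by rewrite ci.
Qed.

Lemma circuit_cart x c i : circuit x c -> \sum_j cart (x j) (x i) * c j = 0.
Proof.
move=> C; have ri := circuit_root C i; have qi := root_form_gt0 ri.
apply: (@mulIf _ (B (x i) (x i))); first by rewrite gt_eqF.
rewrite mul0r mulr_suml; transitivity (2 * B (\sum_j c j *: x j) (x i)).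
  rewrite form_suml mulr_sumr; apply: eq_bigr => j _; rewrite formZl mulrAC.
  by rewrite cartE //; [ring|exact: circuit_root C j].
by rewrite (circuit_rel C) form0l mulr0.
Qed.

Definition good x c h l := c l = 1 /\ B (x l) (x l) = h.

(** Two proportional roots already satisfy a relation, hence make up the whole circuit; positivity
    then forces x_i = - x_j and both coefficients to be 1. *)
Lemma parallel_good x c h i j : circuit x c -> normalized x c h -> i != j ->
  0 < c i -> 0 < c j -> 3 < cart (x i) (x j) * cart (x j) (x i) -> good x c h i.
Proof.
move=> C [n1 h0 hd hg] ij ci cj a3.
have [e|e] := parallel_roots (circuit_root C i) (circuit_root C j) a3.
  have H p : p \in [:: (1, i); (-1 : int, j)] -> 0 < c p.2.
    by rewrite !inE => /orP[] /eqP ->.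
  have H0 : \sum_(p <- [:: (1, i); (-1 : int, j)]) p.1 *: x p.2 = 0.
    by rewrite !big_cons big_nil /= e addr0 scaleN1r scale1r subrr.
  have := circuit_comb C H H0 i j.
  rewrite /comb_coef !big_cons !big_nil /= !eqxx (eq_sym j) (negbTE ij).
  by rewrite !addr0 add0r; clear -ci cj; lia.
have H p : p \in [:: (1, i); (1 : int, j)] -> 0 < c p.2.
  by rewrite !inE => /orP[] /eqP ->.
have H0 : \sum_(p <- [:: (1, i); (1 : int, j)]) p.1 *: x p.2 = 0.
  by rewrite !big_cons big_nil /= e addr0 scalerN addNr.
have {}H := circuit_comb C H H0.
have cE k : c k = if (k == i) || (k == j) then c i else 0.
  have ji : (j == i) = false by rewrite eq_sym (negbTE ij).
  have := H k i; rewrite /comb_coef !big_cons !big_nil /= eqxx ji !addr0 mul1r => <-.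
  rewrite !(eq_sym k); case: (i =P k) => [<-|_]; first by rewrite ji addr0 mul1r.
  by case: eqP => _; rewrite ?add0r ?mul1r ?mul0r.
have c1 : c i = 1.
  have /n1 : forall k, (c i %| c k)%Z.
    by move=> k; rewrite cE; case: ifP.
  by rewrite dvdz1 => /eqP; clear -ci; lia.
split=> //; have qi := root_form_gt0 (circuit_root C i).
have d1 : (B (x i) (x i) %| h)%Z.
  apply: hg => k; rewrite cE; case: ifP => [/orP[]/eqP->|_].
  - by rewrite c1 mulr1.
  - by rewrite c1 mulr1 e !formE opprK.
  - by rewrite mulr0.
by apply: dvdz_eq => //; have := hd i; rewrite c1 mulr1.
Qed.

(* Two roots spanning a G2 system split every root into its projection to their
   plane and a remainder; the quotient of the squared norms of the projection
   and of the root is an integer, so that one of the two parts vanishes. *)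
Lemma G2_root (L S u : V) : root L -> root S -> root u ->
  cart S L = -1 -> cart L S = -3 ->
  let l := cart u L in let s := cart u S in
  l = 0 /\ s = 0 \/ u = (2 * l + s) *: L + (3 * l + 2 * s) *: S.
Proof.
move=> rL rS ru aSL aLS l s.
have qL := root_form_gt0 rL; have qS := root_form_gt0 rS; have qu := root_form_gt0 ru.
have e1 := cartE rS rL; have e2 := cartE rL rS; rewrite aSL in e1; rewrite aLS in e2.
have e3 : l * B L L = 2 * B u L by exact: cartE.
have e4 : s * B S S = 2 * B u S by exact: cartE.
have e5 := cartE rL ru; have e6 := cartE rS ru.
rewrite (formC S L) in e1; rewrite (formC L u) in e5; rewrite (formC S u) in e6.
move: (cart L u) (cart S u) e5 e6 => l' s' e5 e6.
have qLS : B L L = 3 * B S S by move: e1 e2; clear; lia.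
rewrite qLS in e3.
pose w := u - ((2 * l + s) *: L + (3 * l + 2 * s) *: S).
have E1 : l' * B u u = 3 * l * B S S by rewrite e5 -e3; ring.
have E2 : s' * B u u = s * B S S by rewrite e6 -e4; ring.
have wE : B w w = B u u - B S S * (3 * l ^+ 2 + 3 * l * s + s ^+ 2).
  rewrite /w !(formDl, formZl, formNl, formDr, formZr, formNr).
  rewrite (formC L u) (formC S u) (formC S L) qLS.
  set m := 2 * l + s; set n := 3 * l + 2 * s.
  transitivity (B u u - m * (2 * B u L) - n * (2 * B u S) + m * m * (3 * B S S)
    + m * n * (2 * B L S) + n * n * B S S); first by ring.
  by rewrite -e3 -e4 -e2 /m /n; ring.
pose E := l * l' + l' * s + s * s'.
have EE : E * B u u = B S S * (3 * l ^+ 2 + 3 * l * s + s ^+ 2).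
  transitivity (l * (l' * B u u) + (l' * B u u) * s + s * (s' * B u u)).
    by rewrite /E; ring.
  by rewrite E1 E2; ring.
have wE' : B w w = (1 - E) * B u u by rewrite wE mulrBl mul1r EE.
case: (lerP E 0) => E0.
  left; have : 3 * l ^+ 2 + 3 * l * s + s ^+ 2 <= 0.
    by rewrite -(pmulr_rle0 _ qS) -EE pmulr_lle0.
  have e : 4 * (3 * l ^+ 2 + 3 * l * s + s ^+ 2) = 3 * (2 * l + s) ^+ 2 + s ^+ 2 by ring.
  move=> le0; have s2 := sqr_ge0 s; have ls2 := sqr_ge0 (2 * l + s).
  have /eqP : s ^+ 2 = 0 by clear -e le0 s2 ls2; lia.
  have /eqP : (2 * l + s) ^+ 2 = 0 by clear -e le0 s2 ls2; lia.
  by rewrite !sqrf_eq0 => /eqP + /eqP ->; split=> //; lia.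
right; apply/eqP; rewrite -subr_eq0; apply/eqP/form_eq0.
by rewrite -/w wE' pmulr_lle0 //; clear -E0; lia.
Qed.

(** Were all other roots of the circuit orthogonal to these two, the relation would give both 2 c i
    = c j and 3 c i = 2 c j. So by [G2_root] some x_k is an integral combination of x_i and x_j.
    This is the relation of the circuit, which gives c k = 1; it is integral for the coroots as
    well. *)
Lemma G2_good x c h i j : circuit x c -> normalized x c h -> i != j ->
  0 < c i -> 0 < c j -> cart (x j) (x i) = -1 -> cart (x i) (x j) = -3 ->
  exists l, good x c h l.
Proof.
move=> C [n1 h0 hd hg] ij ci cj aji aij.
have ri := circuit_root C i; have rj := circuit_root C j.
have G k := G2_root ri rj (circuit_root C k) aji aij.
have ji : (j == i) = false by rewrite eq_sym (negbTE ij).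
have qi := root_form_gt0 ri; have qj := root_form_gt0 rj.
have ej := cartE rj ri; have ei := cartE ri rj.
rewrite aji in ej; rewrite aij (formC (x i)) in ei.
case: (pickP (fun k => [&& k != i, k != j, 0 < c k &
    (cart (x k) (x i) != 0) || (cart (x k) (x j) != 0)])) => [k|n0]; last first.
  have c0 l k : k != i -> k != j -> l = i \/ l = j -> cart (x k) (x l) * c k = 0.
    move=> ki kj ll; apply/eqP; rewrite mulf_eq0; apply/orP.
    have [ck|ck] := ltrP 0 (c k); last by right; move: (circuit_ge0 C k); lia.
    left; move: (n0 k); rewrite ki kj ck /= => /negbT; rewrite negb_or !negbK.
    by case/andP; case: ll => ->.
  have sumE l : l = i \/ l = j -> cart (x i) (x l) * c i + cart (x j) (x l) * c j = 0.
    move=> ll; have := circuit_cart l C; rewrite (bigD1 i) //= (bigD1 j) /=; last by rewrite ji.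
    by rewrite big1 ?addr0 // => k /andP[ki kj]; exact: c0.
  have := sumE i (or_introl erefl); have := sumE j (or_intror erefl).
  by rewrite !cart_self // aij aji; clear -ci cj; lia.
case/and4P=> ki kj ck nk; case: (G k) => [[e1 e2]|]; first by rewrite e1 e2 in nk.
set l := cart _ _; set s := cart _ _ => xk.
pose Lk : seq (int * I) := [:: (1, k); (- (2 * l + s), i); (- (3 * l + 2 * s), j)].
have H p : p \in Lk -> 0 < c p.2 by rewrite !inE => /or3P[] /eqP ->.
have H0 : \sum_(p <- Lk) p.1 *: x p.2 = 0.
  by rewrite !big_cons big_nil /= addr0 scale1r !scaleNr xk -opprD subrr.
have {}H m := circuit_comb C H H0 m k.
have ck1 : c k = 1.
  have /n1 : forall m, (c k %| c m)%Z.
    move=> m; have := H m; rewrite /Lk /comb_coef !big_cons !big_nil /= eqxx.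
    rewrite !(eq_sym _ k) (negbTE ki) (negbTE kj) !addr0 mul1r => <-.
    exact: dvdz_mull.
  by rewrite dvdz1 => /eqP; clear -ck; lia.
exists k; split=> //; have rk := circuit_root C k; have qk := root_form_gt0 rk.
apply/esym/dvdz_eq => //; first by have := hd k; rewrite ck1 mulr1.
apply: hg => m; have := H m; rewrite ck1 mulr1.
rewrite /Lk /comb_coef !big_cons !big_nil /= eqxx.
rewrite !(eq_sym _ k) (negbTE ki) (negbTE kj) !addr0 mul1r => <-.
have f1 := cartE rk ri; have f2 := cartE rk rj; rewrite -/l in f1; rewrite -/s in f2.
have f3 := cartE ri rk; have f4 := cartE rj rk; rewrite formC in f3; rewrite formC in f4.
have qij : B (x i) (x i) = 3 * B (x j) (x j) by move: ej ei; clear; lia.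
case: (k =P m) => [<-|_]; last rewrite add0r.
  rewrite !(eq_sym _ k) (negbTE ki) (negbTE kj) !addr0 mulr1; exact: dvdzz.
rewrite -f3 in f1; rewrite -f4 in f2.
case: (i =P m) => [<-|_]; last rewrite add0r.
  rewrite ji addr0; apply/dvdzP.
  exists (- (2 * cart (x i) (x k) + 3 * cart (x j) (x k))).
  have e1 : B (x i) (x i) * - (2 * l + s) = - (2 * (l * B (x i) (x i)) + 3 * (s * B (x j) (x j))).
    by rewrite qij; ring.
  by rewrite e1 f1 f2; ring.
case: (j =P m) => [<-|_]; last by rewrite mulr0 dvdz0.
apply/dvdzP; exists (- (cart (x i) (x k) + 2 * cart (x j) (x k))).
have e1 : B (x j) (x j) * - (3 * l + 2 * s) = - (l * B (x i) (x i) + 2 * (s * B (x j) (x j))).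
  by rewrite qij; ring.
by rewrite e1 f1 f2; ring.
Qed.

(** * Moves of a circuit *)

Section Move.
Variables (x : I -> V) (c : I -> int) (h : int) (i : I) (s : seq I).
Hypothesis C : circuit x c.
Hypothesis Nm : normalized x c h.
Hypothesis us : uniq (i :: s).
Let S : int := \sum_(j <- s) - (cart (x j) (x i) * c j).
Hypothesis S_gt0 : 0 < S.
Hypothesis S_lt : S < 2 * c i.
(** The sign makes the new coefficient |c i - S|; for S = c i the index i leaves the support. *)
Let sg : int := if S <= c i then 1 else -1.

Definition move_root k :=
  if k == i then sg *: x i else if k \in s then refl (x i) (x k) else x k.
Definition move_coef k := if k == i then sg * (c i - S) else c k.

Let sg2 : sg * sg = 1.
Proof. by rewrite /sg; case: ifP. Qed.

Lemma sum_move_pred (F : I -> int) :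
  \sum_(k | k != i) (if k \in s then F k else 0) = \sum_(j <- s) F j.
Proof.
move: us => /= /andP[ni us']; rewrite -big_mkcondr /= big_uniq //=.
by apply: eq_bigl => k; case: (k =P i) => // ->; rewrite (negbTE ni).
Qed.

Lemma move_comb (d : I -> int) : \sum_k d k *: move_root k =
  \sum_k (if k == i then sg * d i - \sum_(j <- s) cart (x j) (x i) * d j else d k) *: x k.
Proof.
rewrite (bigD1 i) //= [RHS](bigD1 i) //= /move_root eqxx scalerA mulrC scalerBl.
rewrite -addrA; congr (_ + _); rewrite addrC -sum_move_pred scaler_suml -sumrB.
apply: eq_bigr => k ki; rewrite (negbTE ki); case: ifP => _; last first.
  by rewrite scale0r subr0.
by rewrite /refl scalerBr scalerA mulrC.
Qed.

Lemma move_circuit : circuit move_root move_coef.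
Proof.
have rx k := circuit_root C k.
split.
- move=> k; rewrite /move_root; case: ifP => _.
    rewrite /sg; case: ifP => _; first by rewrite scale1r.
    by rewrite scaleN1r; exact: root_opp.
  by case: ifP => _ //; exact: root_refl.
- move=> k; rewrite /move_coef; case: ifP => _; last exact: circuit_ge0 C k.
  by rewrite /sg; case: ifP; clear; lia.
- have [j js cj] : exists2 j, j \in s & 0 < c j.
    case: (altP (@hasP _ (fun j => 0 < c j) s)) => // /hasPn H.
    suff S0 : S = 0 by move: S_gt0; rewrite S0.
    rewrite /S big_seq big1 // => j /H; have := circuit_ge0 C j => c0 nc.
    have -> : c j = 0 by clear -c0 nc; lia.
    by rewrite mulr0 oppr0.
  exists j; rewrite /move_coef; case: eqP => // e.
  by move: us; rewrite /= -e js.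
- rewrite move_comb -[RHS](circuit_rel C); apply: eq_bigr => k _; congr (_ *: _).
  case: eqP => [->|/eqP ki]; last by rewrite /move_coef (negbTE ki).
  rewrite {1}/move_coef eqxx mulrA sg2 mul1r.
  rewrite (_ : \sum_(j <- s) _ = - S) ?opprK ?subrK //.
  rewrite /S sumrN opprK !big_seq; apply: eq_bigr => j js; rewrite /move_coef.
  by case: eqP => // e; move: us; rewrite /= -e js.
move=> d supp; rewrite move_comb.
pose e k := if k == i then sg * d i - \sum_(j <- s) cart (x j) (x i) * d j else d k.
move=> e0.
have ci : 0 < c i by move: S_gt0 S_lt; clear; lia.
have suppe k : c k = 0 -> e k = 0.
  rewrite /e; case: eqP => [->|/eqP ki] ck; first by rewrite ck in ci.
  by apply: supp; rewrite /move_coef (negbTE ki).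
have U := circuit_uniq C suppe e0.
have ne k : k != i -> e k = d k by move=> ki; rewrite /e (negbTE ki).
have Ui j : j != i -> sg * d i * c j = d j * (c i - S).
  move=> ji; have := U i j; rewrite (ne j) // {1}/e eqxx mulrBl => H.
  have -> : sg * d i * c j = d j * c i + (\sum_(k <- s) cart (x k) (x i) * d k) * c j.
    by rewrite -H subrK.
  rewrite mulrBr; congr (_ + _); rewrite mulr_suml /S mulr_sumr -sumrN !big_seq.
  apply: eq_bigr => k ks; have ki : k != i.
    by apply: contraTneq us => e1; rewrite /= -e1 ks.
  have := U k j; rewrite (ne k) // (ne j) // => {}H.
  by rewrite mulrN opprK -mulrA H; ring.
move=> k j; rewrite /move_coef.
case: (k =P i) => [->|/eqP ki]; case: (j =P i) => [->|/eqP ji] //.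
- have := Ui j ji; rewrite -[d i * c j]mul1r -sg2 => H.
  by rewrite [RHS]mulrCA -H; ring.
- have := Ui k ki; rewrite -[d i * c k]mul1r -sg2 => H.
  by rewrite [LHS]mulrCA -H; ring.
by have := U k j; rewrite !ne.
Qed.

Lemma move_norm k : B (move_root k) (move_root k) = B (x k) (x k).
Proof.
rewrite /move_root; case: eqP => [->|_].
  by rewrite formZl formZr mulrA sg2 mul1r.
by case: ifP => // _; apply: refl_form; exact: circuit_root C _.
Qed.

Let unit_sg (d m : int) : (d %| sg * m)%Z = (d %| m)%Z.
Proof. by rewrite /sg; case: ifP => _; rewrite ?mul1r // mulN1r rpredN. Qed.

Lemma move_normalized : normalized move_root move_coef h.
Proof.
have [n1 h0 hd hg] := Nm.
have nis k : k \in s -> k != i.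
  by move=> ks; apply: contraTneq us => e1; rewrite /= -e1 ks.
(* For the coroots too, the i-th coefficient changes by an integral combination of the others, now
   with the transposed Cartan integers. *)
have qS : B (x i) (x i) * S =
    \sum_(j <- s) - (cart (x i) (x j) * (B (x j) (x j) * c j)).
  rewrite /S mulr_sumr; apply: eq_bigr => j _; rewrite mulrN; congr (- _).
  have := cartE (circuit_root C j) (circuit_root C i).
  have := cartE (circuit_root C i) (circuit_root C j); rewrite formC => <- H.
  by rewrite !mulrA -H; ring.
split=> //.
- move=> d dc; apply: n1 => k; have [->|ki] := eqVneq k i; last first.
    by have := dc k; rewrite /move_coef (negbTE ki).
  have := dc i; rewrite /move_coef eqxx unit_sg => di.
  rewrite -(subrK S (c i)); apply: rpredD => //; rewrite /S big_seq.
  apply: rpred_sum => j js; rewrite rpredN dvdz_mull //.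
  by have := dc j; rewrite /move_coef (negbTE (nis j js)).
- move=> k; rewrite move_norm /move_coef; case: eqP => [->|_] //.
  rewrite mulrCA unit_sg mulrBr rpredB // qS; apply: rpred_sum => j _.
  by rewrite rpredN dvdz_mull.
move=> d dc; apply: hg => k; have [->|ki] := eqVneq k i; last first.
  by have := dc k; rewrite move_norm /move_coef (negbTE ki).
have := dc i; rewrite move_norm /move_coef eqxx mulrCA unit_sg mulrBr => di.
rewrite -(subrK (B (x i) (x i) * S) (_ * c i)); apply: rpredD => //.
rewrite qS big_seq; apply: rpred_sum => j js; rewrite rpredN dvdz_mull //.
by have := dc j; rewrite move_norm /move_coef (negbTE (nis j js)).
Qed.
End Move.

(** Induction provides [move_sum]: a move with 0 < S < 2 c i lowers the coefficient sum, and the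
    good index of the result is good for the given circuit unless it is i with |c i - S| = 1. *)
Lemma good_exists x c h : circuit x c -> normalized x c h -> exists l, good x c h l.
Proof.
have [n] := ubnP (\sum_k `|c k|)%N; elim: n x c => // n IH x c lt_n C Nm.
have [n1 h0 hd hg] := Nm.
case: (pickP (fun l => (c l == 1) && (B (x l) (x l) == h))) => [l|ng].
  by case/andP=> /eqP ? /eqP ?; exists l.
have notg l : ~ good x c h l by move=> [e1 e2]; move: (ng l); rewrite e1 e2 !eqxx.
have rx i := circuit_root C i.
exfalso; apply: (@minimal_circuit_absurd I (fun i j => B (x i) (x j))
  (fun i j => cart (x j) (x i)) c h) => //.
- by move=> i j; rewrite formC.
- by move=> i; exact: root_form_gt0.
- by move=> i j; rewrite cartE // formC.
- exact: circuit_ge0 C.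
- exact: circuit_neq0 C.
- by move=> i; exact: circuit_cart C.
- move=> i j ij ci cj; rewrite leNgt; apply/negP => a3.
  by apply: (notg i); apply: (parallel_good C Nm ij ci cj); rewrite mulrC.
- move=> i j ij ci cj a0; rewrite leNgt; apply/negP => a2.
  have a3 : cart (x j) (x i) * cart (x i) (x j) = 3.
    suff : cart (x j) (x i) * cart (x i) (x j) <= 3 by move: a2; clear; lia.
    rewrite leNgt; apply/negP => a3; apply: (notg i).
    by apply: (parallel_good C Nm ij ci cj); rewrite mulrC.
  have [[e1 e2]|[e1 e2]] := mul_eq3 a3 a0.
    by have [l /notg] := G2_good C Nm ij ci cj e1 e2.
  by rewrite eq_sym in ij; have [l /notg] := G2_good C Nm ij cj ci e2 e1.
- by move=> i c1 e; apply: (notg i).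
- move=> i s ci us S /andP[S0 S2].
  have C' := move_circuit C us S0 S2; have Nm' := move_normalized C Nm us.
  have [|l [l1 l2]] := IH _ _ _ C' Nm'.
    rewrite ltnS in lt_n; apply: leq_trans lt_n.
    rewrite (bigD1 i) //= [X in (_ < X)%N](bigD1 i) //= -addSn leq_add //.
      by rewrite /move_coef eqxx -/S; case: ifP; move: S0 S2; clear; lia.
    by apply: leq_sum => k ki; rewrite /move_coef (negbTE ki).
  rewrite (move_norm _ _ C) in l2; have [e|/eqP li] := (l =P i); last first.
    by exfalso; apply: (notg l); move: l1; rewrite /move_coef (negbTE li).
  rewrite -e l2; split=> //; move: l1; rewrite e /move_coef eqxx -/S.
  by case: ifP => _; clear; lia.
- move=> L; rewrite -comb_form; exact: form_ge0.
move=> L supp neg i j; apply: (circuit_comb C supp).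
by apply: form_eq0; rewrite comb_form.
Qed.

(** Meant for the set of roots whose reflections lie in a given subgroup. *)
Definition refl_closed (Z : V -> Prop) :=
  forall u v, root u -> root v -> Z u -> Z v -> Z (refl v u).

(* Reflecting x_l in an x_j with negative product decreases c j and changes no other
   coefficient, until x_l is the opposite of some x_j. *)
Lemma good_redundant x c l (Z : V -> Prop) :
  (forall i, root (x i)) -> (forall i, 0 <= c i) -> \sum_i c i *: x i = 0 ->
  c l = 1 -> (forall j, (B (x l) (x l) %| B (x j) (x j) * c j)%Z) ->
  refl_closed Z -> (forall j, j != l -> 0 < c j -> Z (x j)) -> Z (x l).
Proof.
have [n] := ubnP (\sum_k `|c k|)%N; elim: n x c => // n IH x c lt_n rx c0 c_rel cl dl Zr Zx.
have [j /and3P[jl cj bj]] : exists j, [&& j != l, 0 < c j & B (x j) (x l) < 0].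
  case: (pickP (fun j => [&& j != l, 0 < c j & B (x j) (x l) < 0])) => [j|n0].
    by exists j.
  have : B (\sum_i c i *: x i) (x l) = 0 by rewrite c_rel form0l.
  rewrite form_suml (bigD1 l) //= formZl cl mul1r => e.
  have : B (x l) (x l) <= 0.
    rewrite -e lerDl sumr_ge0 // => j jl; rewrite formZl.
    move: (n0 j); rewrite jl /=; have := c0 j; rewrite le_eqVlt.
    case/orP => [/eqP <-|cj]; first by rewrite mul0r.
    by rewrite cj /= ltNge => /negbFE bj; apply: mulr_ge0 => //; exact: ltW.
  by rewrite leNgt root_form_gt0.
have Zj := Zx j jl cj; have rj := rx j; have rl := rx l.
have [a3|a3] := ltrP 3 (cart (x l) (x j) * cart (x j) (x l)).
  have [->//|->] := parallel_roots rl rj a3.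
  have := Zr _ _ rj rj Zj Zj.
  by rewrite /refl cart_self // -{1}[x j]scale1r -scalerBl scaleN1r.
have qj := root_form_gt0 rj; have ql := root_form_gt0 rl.
have ej := cartE rl rj; have el := cartE rj rl.
pose k := - cart (x l) (x j).
have ek : k * B (x j) (x j) = - cart (x j) (x l) * B (x l) (x l).
  by rewrite /k !mulNr ej el formC.
have k0 : 0 < k by rewrite -(pmulr_lgt0 _ qj) /k mulNr ej formC; clear -bj; lia.
have k0' : 0 < - cart (x j) (x l).
  by rewrite -(pmulr_lgt0 _ ql) mulNr el; clear -bj; lia.
(* If k > 1 the other Cartan integer is -1 and |x_l|^2 = k |x_j|^2; this divides |x_j|^2 c j, so k
   divides c j. *)
have ck : k <= c j.
  have [k1|k1] := lerP k 1; first by apply: le_trans k1 _; clear -cj; lia.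
  have e1 : - cart (x j) (x l) = 1 by rewrite /k in k0 k1; clear -a3 k0' k1; nia.
  have := dl j; rewrite -[B (x l) (x l)]mul1r -e1 -ek [k * _]mulrC dvdz_mul2l ?gt_eqF //.
  case/dvdzP => q e; move: cj; rewrite e pmulr_lgt0 // => q0.
  by rewrite -{1}[k]mul1r ler_wpM2r // ltW.
pose x' i := if i == l then refl (x j) (x l) else x i.
pose c' i := if i == j then c j - k else c i.
have rx' i : root (x' i).
  by rewrite /x'; case: ifP => // _; exact: root_refl.
have Zl : Z (x' l).
  apply: (IH x' c') => //.
  - rewrite ltnS in lt_n; apply: leq_trans lt_n.
    rewrite (bigD1 j) //= [X in (_ < X)%N](bigD1 j) //= -addSn leq_add //.
      by rewrite /c' eqxx; clear -k0 ck; lia.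
    by apply: leq_sum => i ij; rewrite /c' (negbTE ij).
  - by move=> i; rewrite /c'; case: ifP => // _; clear -ck; lia.
  - rewrite -[RHS]c_rel (bigD1 l) //= [RHS](bigD1 l) //= (bigD1 j) //=.
    rewrite [in RHS](bigD1 j) //= !addrA; congr (_ + _).
      rewrite /c' /x' eqxx (negbTE jl) eqxx (eq_sym l) (negbTE jl) cl !scale1r.
      by rewrite /refl scalerBl /k scaleNr opprK addrACA -addrA addNr addr0.
    apply: eq_bigr => i /andP[il ij].
    by rewrite /c' /x' (negbTE il) (negbTE ij).
  - by rewrite /c' eq_sym (negbTE jl).
  - move=> i; rewrite /c' /x' eqxx refl_form //; case: (i =P j) => [->|_].
      rewrite (negbTE jl) mulrBr rpredB // [_ * k]mulrC ek dvdz_mull //.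
    by case: (i =P l) => [->|_]; rewrite ?refl_form.
  - move=> i il; rewrite /c' /x' (negbTE il); case: eqP => [->//|_]; exact: Zx.
have := Zr _ _ (rx' l) rj Zl Zj.
by rewrite /x' eqxx reflK.
Qed.

Lemma circuit_redundant x c : circuit x c -> exists2 l, 0 < c l &
  forall Z, refl_closed Z -> (forall j, j != l -> 0 < c j -> Z (x j)) -> Z (x l).
Proof.
move=> C; pose g := \big[gcdn/0%N]_i absz (c i).
have gd i : (g %| c i)%Z by rewrite dvdzE; apply: (biggcdn_inf i).
have [i0 ci0] := circuit_neq0 C.
have g0 : 0 < g%:Z.
  by have := gd i0; rewrite ltz_nat lt0n; apply: contraTneq => ->; rewrite dvd0z gt_eqF.
have gn0 : g%:Z != 0 by rewrite gt_eqF.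
pose c' i := (c i %/ g)%Z.
have cE i : c i = c' i * g by rewrite /c' divzK.
have pos i : (0 < c' i) = (0 < c i) by rewrite cE pmulr_lgt0.
have C' : circuit x c'.
  split; first exact: circuit_root C.
  - by move=> i; have := circuit_ge0 C i; rewrite cE pmulr_lge0.
  - by exists i0; rewrite pos.
  - apply: form_eq0; set v := \sum_i _; have gv : g%:Z *: v = 0.
      rewrite -(circuit_rel C) scaler_sumr; apply: eq_bigr => i _.
      by rewrite scalerA mulrC -cE.
    have : g%:Z * B v v <= 0 by rewrite -formZl gv form0l.
    by rewrite pmulr_rle0.
  move=> d supp d0 i j; apply: (mulIf gn0).
  rewrite -!mulrA -!cE; apply: (circuit_uniq C) => // k ck; apply: supp.
  by apply: (mulIf gn0); rewrite -cE ck mul0r.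
pose h := \big[gcdn/0%N]_i absz (B (x i) (x i) * c' i).
have hd i : (h %| B (x i) (x i) * c' i)%Z by rewrite dvdzE; apply: (biggcdn_inf i).
have Nm : normalized x c' h.
  split=> //.
  - move=> d dc; rewrite -(@dvdz_mul2r g) ?gt_eqF // mul1r dvdzE; apply/dvdn_biggcdP => i _.
    have := dc i; rewrite -(@dvdz_mul2r g) ?gt_eqF // -cE.
    by rewrite dvdzE.
  - have := hd i0; rewrite ltz_nat lt0n; apply: contraTneq => ->; rewrite dvd0z gt_eqF //.
    by rewrite mulr_gt0 ?pos // root_form_gt0 //; exact: circuit_root C i0.
  by move=> d dq; rewrite dvdzE; apply/dvdn_biggcdP => i _; have := dq i; rewrite dvdzE.
have [l [l1 l2]] := good_exists C' Nm.
exists l; first by rewrite -pos l1.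
move=> Z Zr Zx; apply: (@good_redundant x c' l Z) => //.
- exact: circuit_root C.
- exact: circuit_ge0 C'.
- exact: circuit_rel C'.
- by move=> j; rewrite l2.
by move=> j jl; rewrite pos; exact: Zx.
Qed.

End Circuit.
End Roots.

(** * The reflection representation *)

Section IntegralGL.
Variable n : nat.

Definition inverse_pair (p : 'M[int]_n * 'M[int]_n) :=
  (p.1 *m p.2 == 1%:M) && (p.2 *m p.1 == 1%:M).

(* The group GL_n(Z), with the inverse matrix stored alongside. *)
Record glz := Glz { glz_val : 'M[int]_n * 'M[int]_n; _ : inverse_pair glz_val }.

HB.instance Definition _ := [isSub for glz_val].
HB.instance Definition _ := [Choice of glz by <:].

Lemma glz_mulP (p q : glz) : inverse_pair
  ((glz_val p).1 *m (glz_val q).1, (glz_val q).2 *m (glz_val p).2).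
Proof.
case: p q => [[a a'] /andP[/eqP /= e1 /eqP e2]] [[b b'] /andP[/eqP /= e3 /eqP e4]].
by rewrite /inverse_pair /= mulmxA -(mulmxA a) e3 mulmx1 e1 mulmxA -(mulmxA b') e2 mulmx1 e4 eqxx.
Qed.

Lemma glz_oneP : inverse_pair (1%:M, 1%:M).
Proof. by rewrite /inverse_pair /= mulmx1 eqxx. Qed.

Lemma glz_invP (p : glz) : inverse_pair ((glz_val p).2, (glz_val p).1).
Proof. by case: p => [[a a'] /andP[/= e1 e2]]; rewrite /inverse_pair /= e1 e2. Qed.

Definition glz_mul p q := Glz (glz_mulP p q).
Definition glz_one := Glz glz_oneP.
Definition glz_inv p := Glz (glz_invP p).

Lemma glz_mulA : associative glz_mul.
Proof. by move=> p q r; apply: val_inj => /=; rewrite !mulmxA. Qed.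

Lemma glz_mul1 : left_id glz_one glz_mul.
Proof. by move=> [[a a'] ?]; apply: val_inj => /=; rewrite mul1mx mulmx1. Qed.

Lemma glz_mulr1 : right_id glz_one glz_mul.
Proof. by move=> [[a a'] ?]; apply: val_inj => /=; rewrite mul1mx mulmx1. Qed.

Lemma glz_mulV : left_inverse glz_one glz_inv glz_mul.
Proof.
by move=> [[a a'] H]; have /andP[/eqP /= e1 /eqP e2] := H; apply: val_inj => /=; rewrite e2.
Qed.

Lemma glz_mulrV : right_inverse glz_one glz_inv glz_mul.
Proof.
by move=> [[a a'] H]; have /andP[/eqP /= e1 /eqP e2] := H; apply: val_inj => /=; rewrite e1.
Qed.

HB.instance Definition _ := isGroup.Build glz glz_mulA glz_mul1 glz_mulr1 glz_mulV glz_mulrV.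

Definition glz_mx (p : glz) := (glz_val p).1.

Lemma glz_mxM (p q : glz) : glz_mx (p * q)%g = glz_mx p *m glz_mx q.
Proof. by []. Qed.

Lemma glz_mx_inj : injective glz_mx.
Proof.
move=> [[a a'] H] [[b b'] H'] /= e; rewrite /glz_mx /= in e; apply: val_inj => /=.
have /andP[_ /eqP /= e2] := H; have /andP[/eqP /= e3 _] := H'.
by rewrite e -[a']mulmx1 -e3 mulmxA -e e2 mul1mx.
Qed.

Lemma glz_mxX (p : glz) k : glz_mx (p ^+ k)%g = iter k (mulmx (glz_mx p)) 1%:M.
Proof. by elim: k => [|k IH]; rewrite ?expg0 ?expgS ?glz_mxM ?IH. Qed.
End IntegralGL.

Lemma int_kernel a b (A : 'M[int]_(a, b)) : (b < a)%N ->
  exists2 v : 'rV[int]_a, v != 0 & v *m A = 0.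
Proof.
move=> ba; pose AQ := map_mx (intr : int -> rat) A.
have [v /sub_kermxP vA v0] : exists2 v : 'rV_a, (v <= kermx AQ)%MS & v != 0.
  apply/rowV0Pn; rewrite -mxrank_eq0 mxrank_ker -lt0n subn_gt0.
  exact: leq_ltn_trans (rank_leq_col _) ba.
pose D := \prod_j denq (v 0 j).
pose u : 'rV[int]_a := \row_j (numq (v 0 j) * \prod_(k | k != j) denq (v 0 k)).
have D0 : D != 0 by apply/prodf_neq0 => j _; exact: denq_neq0.
have uE : map_mx intr u = (D%:~R : rat) *: v.
  apply/rowP => j; rewrite !mxE /D [in RHS](bigD1 j) //= !intrM numqE; ring.
have D0' : (D%:~R : rat) != 0 by rewrite intr_eq0.
exists u.
  apply: contraNneq v0 => u0; have := uE; rewrite u0 map_mx0 => /esym/eqP.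
  by rewrite scaler_eq0 (negbTE D0').
have : map_mx (intr : int -> rat) (u *m A) = 0.
  by rewrite map_mxM uE -scalemxAl vA scaler0.
move/matrixP => e; apply/matrixP => i j; have := e i j.
by rewrite !mxE => /eqP; rewrite intr_eq0 => /eqP.
Qed.

(** * An integral Cartan matrix and its simple reflections *)

Section Cartan.
Variables (n : nat) (m : 'I_n -> 'I_n -> nat).
Hypothesis m_crys : forall i j : 'I_n, (i < j)%N -> m i j \in [:: 2; 3; 4; 6]%N.

Definition exponent (i j : 'I_n) := if (i < j)%N then m i j else m j i.

(** Opposite entries have product 4 cos^2 (pi / m); the last branch is the exponent 6. The order of
    the indices decides which root of a multiple bond is long, and nothing has to match around
    cycles, because each Coxeter relation involves only two indices. *)
Definition cartan_int (k i : 'I_n) : int :=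
  if k == i then 2 else
  match exponent k i with
  | 2 => 0
  | 3 => -1
  | 4 => if (k < i)%N then -1 else -2
  | _ => if (k < i)%N then -1 else -3
  end.

Lemma exponentC i j : i != j -> exponent i j = exponent j i.
Proof. by rewrite /exponent neq_ltn => /orP[] ij; rewrite ij ltnNge ltnW. Qed.

Lemma exponentP i j : i != j -> exponent i j \in [:: 2; 3; 4; 6]%N.
Proof. by rewrite /exponent neq_ltn => /orP[] ij; rewrite ?ij ?ltnNge ?(ltnW ij) m_crys. Qed.

Lemma cartan_intP i j : i != j -> let a := cartan_int i j in let b := cartan_int j i in
  [\/ [/\ exponent i j = 2%N, a = 0 & b = 0],
      [/\ exponent i j = 3%N, a = -1 & b = -1],
      [/\ exponent i j = 4%N & (a = -1 /\ b = -2) \/ (a = -2 /\ b = -1)] |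
      [/\ exponent i j = 6%N & (a = -1 /\ b = -3) \/ (a = -3 /\ b = -1)]].
Proof.
move=> ij /=; have := exponentP ij; rewrite /cartan_int (eq_sym j) (negbTE ij).
rewrite (exponentC (i := j)) 1?eq_sym // !inE.
case/or4P => /eqP ->; [exact: Or41|exact: Or42|apply: Or43|apply: Or44];
  by move: ij; rewrite neq_ltn => /orP[] ij; rewrite ij ltnNge ltnW //; split=> //; [left|right].
Qed.

Definition simple_root i : 'rV[int]_n := delta_mx 0 i.
Local Notation e_ := simple_root.

Definition coroot_form i (v : 'rV[int]_n) : int := \sum_k v 0 k * cartan_int k i.

Definition simple_mx i : 'M[int]_n := 1%:M - (\col_k cartan_int k i) *m e_ i.

Lemma simple_mxE i v : v *m simple_mx i = v - coroot_form i v *: e_ i.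
Proof.
rewrite mulmxBr mulmx1 mulmxA; congr (_ - _).
rewrite [v *m _]mx11_scalar mul_scalar_mx; congr (_ *: _).
by rewrite mxE; apply: eq_bigr => k _; rewrite mxE.
Qed.

Lemma coroot_formD i u v : coroot_form i (u + v) = coroot_form i u + coroot_form i v.
Proof.
by rewrite -big_split /=; apply: eq_bigr => k _; rewrite mxE mulrDl.
Qed.

Lemma coroot_formZ i k v : coroot_form i (k *: v) = k * coroot_form i v.
Proof. by rewrite mulr_sumr; apply: eq_bigr => j _; rewrite mxE mulrA. Qed.

Lemma coroot_form_simple i j : coroot_form i (e_ j) = cartan_int j i.
Proof.
rewrite /coroot_form (bigD1 j) //= mxE !eqxx mul1r big1 ?addr0 // => k kj.
by rewrite mxE (negbTE kj) andbF mul0r.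
Qed.

Lemma cartan_int_diag i : cartan_int i i = 2.
Proof. by rewrite /cartan_int eqxx. Qed.

(** Expressions of this shape are stable, so that powers of a product of two simple reflections are
    computed by rewriting. *)
Lemma simple_mx_step i j v x y :
  (v + x *: e_ i + y *: e_ j) *m simple_mx i =
  v + (- x - coroot_form i v - y * cartan_int j i) *: e_ i + y *: e_ j.
Proof.
rewrite simple_mxE !coroot_formD !coroot_formZ !coroot_form_simple cartan_int_diag.
by apply/rowP => k; rewrite !mxE; ring.
Qed.

Lemma simple_mx_step' i j v x y :
  (v + x *: e_ i + y *: e_ j) *m simple_mx j =
  v + x *: e_ i + (- y - coroot_form j v - x * cartan_int i j) *: e_ j.
Proof. by rewrite addrAC simple_mx_step addrAC. Qed.

Lemma simple_mxK i : simple_mx i *m simple_mx i = 1%:M.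
Proof.
apply/row_matrixP => k; rewrite !rowE mulmxA mulmx1.
have := simple_mx_step i i (delta_mx 0 k) 0 0.
rewrite !scale0r !addr0 => ->.
have := simple_mx_step i i (delta_mx 0 k)
  (- 0 - coroot_form i (delta_mx 0 k) - 0 * cartan_int i i) 0.
rewrite scale0r addr0 => ->.
by apply/rowP => l; rewrite !mxE; ring.
Qed.

Lemma simple_mx_braid i j : i != j ->
  iter (exponent i j) (mulmx (simple_mx i *m simple_mx j)) 1%:M = 1%:M.
Proof.
move=> ij; apply/row_matrixP => k; rewrite !rowE mulmx1.
set v := delta_mx 0 k.
have v0 : v = v + 0 *: e_ i + 0 *: e_ j by rewrite !scale0r !addr0.
have [[-> ea eb]|[-> ea eb]|[-> ab]|[-> ab]] := cartan_intP ij;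
  rewrite /= !mulmxA mulmx1 [in LHS]v0 ?(simple_mx_step, simple_mx_step').
- by rewrite ea eb; apply/rowP => l; rewrite !mxE; ring.
- by rewrite ea eb; apply/rowP => l; rewrite !mxE; ring.
- by case: ab => -[-> ->]; apply/rowP => l; rewrite !mxE; ring.
by case: ab => -[-> ->]; apply/rowP => l; rewrite !mxE; ring.
Qed.
End Cartan.

(** * Words and lengths *)

Section Weyl.
Variables (W : finGroupType) (n : nat) (s : 'I_n -> W) (m : 'I_n -> 'I_n -> nat).
Hypothesis cox : finite_coxeter_system s m.
Hypothesis m_crys : forall i j : 'I_n, (i < j)%N -> m i j \in [:: 2; 3; 4; 6]%N.
Local Notation e_ := (@simple_root n).
Local Notation cartan := (cartan_int m).

Lemma simple_invol i : (s i * s i)%g = 1%g.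
Proof. by have [H _] := coxeter_rel cox; move: (H i); rewrite expgS expg1. Qed.

Lemma simple_inv i : ((s i)^-1)%g = s i.
Proof. by apply: (mulgI (s i)); rewrite mulgV simple_invol. Qed.

Definition wprod (x : seq 'I_n) : W := (\prod_(i <- x) s i)%g.

Lemma wprod_cat x y : wprod (x ++ y) = (wprod x * wprod y)%g.
Proof. exact: big_cat. Qed.

Lemma wprod_cons i x : wprod (i :: x) = (s i * wprod x)%g.
Proof. exact: big_cons. Qed.

Lemma wprod_nil : wprod [::] = 1%g.
Proof. exact: big_nil. Qed.

Lemma word_exists (w : W) : exists k, [exists x : k.-tuple 'I_n, wprod x == w].
Proof.
have : w \in <<[set s i | i : 'I_n]>>%g by rewrite (coxeter_gen cox) inE.
case/gen_prodgP => k [c cs ->].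
have /fin_all_exists[g gE] : forall j : 'I_k, exists i, c j = s i.
  by move=> j; have /imsetP[i _ ->] := cs j; exists i.
exists k; apply/existsP; exists [tuple g j | j < k]; apply/eqP.
by rewrite /wprod big_tuple; apply: eq_bigr => j _; rewrite tnth_mktuple gE.
Qed.

Definition len (w : W) : nat := ex_minn (word_exists w).

Lemma len_wprod x : (len (wprod x) <= size x)%N.
Proof.
rewrite /len; case: ex_minnP => k _; apply.
by apply/existsP; exists (in_tuple x); rewrite eqxx.
Qed.

Lemma len_word w : exists2 x, wprod x = w & size x = len w.
Proof.
rewrite /len; case: ex_minnP => k /existsP[x /eqP xw] _.
by exists x => //; rewrite size_tuple.
Qed.

Lemma len_mul x w : (len (wprod x * w) <= size x + len w)%N.
Proof.
have [y <- <-] := len_word w; rewrite -wprod_cat -size_cat; exact: len_wprod.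
Qed.

Lemma simpleK i w : (s i * (s i * w))%g = w.
Proof. by rewrite mulgA simple_invol mul1g. Qed.

Fixpoint alt (i j : 'I_n) k : seq 'I_n := if k is k'.+1 then i :: alt j i k' else [::].

Lemma size_alt i j k : size (alt i j k) = k.
Proof. by elim: k i j => //= k IH i j; rewrite IH. Qed.

Lemma alt_of_word i j (x : seq 'I_n) : all [in [:: i; j]] x -> sorted [rel a b | a != b] (i :: x) ->
  i :: x = alt i j (size x).+1.
Proof.
elim: x i j => [|k x IH] i j //= /andP[kij xij] /andP[ik px].
have -> : k = j by move: kij; rewrite !inE eq_sym (negbTE ik) => /eqP.
have kj : k = j by move: kij; rewrite !inE eq_sym (negbTE ik) => /eqP.
rewrite [j :: x](IH j i) //=; last by rewrite -kj.
by apply: sub_all xij => a; rewrite !inE orbC.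
Qed.

Lemma alt_braid i j : i != j ->
  wprod (alt i j (exponent m i j)) = wprod (alt j i (exponent m i j)).
Proof.
move=> ij; have rel : ((s i * s j) ^+ exponent m i j = 1)%g.
  have [_ H] := coxeter_rel cox; rewrite /exponent; move: ij; rewrite neq_ltn.
  case/orP => ij; first by rewrite ij; exact: H.
  rewrite ltnNge ltnW //=; apply: (can_inj (@invgK W)).
  by rewrite -expgVn invMg !simple_inv invg1; exact: H.
apply: (mulIg (wprod (alt j i (exponent m i j)))^-1%g); rewrite mulgV.
have := exponentP m_crys ij; rewrite !inE => /or4P[] /eqP e; rewrite e in rel *;
  by rewrite /= !wprod_cons wprod_nil !invMg !simple_inv invg1 !mulg1 ?mul1g -rel
    !expgS expg0 !mulgA ?mulg1.
Qed.

(** * Positivity of roots and faithfulness *)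

Section Representation.
Variable rho : W -> 'M[int]_n.
Hypothesis rho1 : rho 1%g = 1%:M.
Hypothesis rhoM : forall x y, rho (x * y)%g = rho x *m rho y.
Hypothesis rho_simple : forall i, rho (s i) = simple_mx m i.

Lemma coroot_form0 i : coroot_form m i 0 = 0.
Proof. by rewrite /coroot_form big1 // => k _; rewrite mxE mul0r. Qed.

(* Up to their order, the coordinates of x e_i + y e_j after k alternating simple
   reflections, starting with that of e_j; a and b are the Cartan integers
   (i, j) and (j, i). *)
Fixpoint alt_coef (a b x y : int) k : int * int :=
  if k is k'.+1 then alt_coef b a (- y - x * a) x k' else (x, y).

Lemma alt_coefE i j x y k : exists b : bool,
  (x *: e_ i + y *: e_ j) *m rho (wprod (alt j i k)) =
  let: (p, q) := alt_coef (cartan i j) (cartan j i) x y k in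
  if b then p *: e_ i + q *: e_ j else p *: e_ j + q *: e_ i.
Proof.
elim: k i j x y => [|k IH] i j x y; first by exists true; rewrite wprod_nil rho1 mulmx1.
rewrite [alt _ _ _]/= wprod_cons rhoM mulmxA rho_simple -[x *: e_ i]add0r simple_mx_step'.
rewrite coroot_form0 subr0 add0r addrC /=.
by have [b ->] := IH j i (- y - x * cartan i j) x; exists (~~ b); case: alt_coef => p q; case: b.
Qed.

(** Positivity in the dihedral case, a finite computation for each of the exponents 2, 3, 4, 6. *)
Lemma alt_coef_ge0 i j k : i != j -> (k < exponent m i j)%N ->
  let: (p, q) := alt_coef (cartan i j) (cartan j i) 1 0 k in 0 <= p /\ 0 <= q.
Proof.
move=> ij.
have [[-> -> ->]|[-> -> ->]|[->]|[->]] := cartan_intP m_crys ij; last 2 first.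
- by case=> -[-> ->]; do 4?[case: k => [|k]].
- by case=> -[-> ->]; do 6?[case: k => [|k]].
- by do 2?[case: k => [|k]].
by do 3?[case: k => [|k]].
Qed.

Lemma alt_action i j k : i != j -> (k < exponent m i j)%N -> exists p q : int,
  [/\ 0 <= p, 0 <= q & e_ i *m rho (wprod (alt j i k)) = p *: e_ i + q *: e_ j].
Proof.
move=> ij /(alt_coef_ge0 ij); have [b] := alt_coefE i j 1 0 k.
rewrite scale1r scale0r addr0 => ->; case: alt_coef => p q [p0 q0].
by case: b; [exists p, q|exists q, p; rewrite addrC].
Qed.

Lemma row_nonneg_comb (p q : int) (u v : 'rV[int]_n) : 0 <= p -> 0 <= q ->
  (forall l, 0 <= u 0 l) -> (forall l, 0 <= v 0 l) ->
  forall l, 0 <= (p *: u + q *: v) 0 l.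
Proof. by move=> p0 q0 u0 v0 l; rewrite !mxE addr_ge0 // mulr_ge0. Qed.

Lemma word_max (w : W) (J : pred 'I_n) j : J j -> (len (s j * w) < len w)%N ->
  exists x v, [/\ all J x, (0 < size x)%N, w = (wprod x * v)%g,
    (size x + len v = len w)%N & forall i, J i -> (len v <= len (s i * v))%N].
Proof.
move=> Jj lj.
pose P k := [exists x : k.-tuple 'I_n, all J x &&
  (k + len ((wprod x)^-1 * w) <= len w)%N].
have P1 : P 1%N.
  apply/existsP; exists [tuple j]; rewrite /= Jj /= wprod_cons wprod_nil mulg1.
  by rewrite simple_inv.
have Pb k : P k -> (k <= len w)%N.
  by case/existsP => x /andP[_]; apply: leq_trans; exact: leq_addr.
case: (ex_maxnP (ex_intro (fun k => P k) _ P1) Pb) => k /existsP[x /andP[Jx xw]] kmax.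
have k1 := kmax _ P1; set v := ((wprod x)^-1 * w)%g in xw *.
have wE : w = (wprod x * v)%g by rewrite /v mulKVg.
exists x, v; split=> //.
- by rewrite size_tuple.
- by apply/eqP; rewrite eqn_leq; have := len_mul x v; rewrite -wE size_tuple xw => ->.
move=> i Ji; rewrite leqNgt; apply/negP => lv.
suff /kmax : P k.+1 by rewrite ltnn.
apply/existsP; exists [tuple of rcons x i]; rewrite all_rcons Ji Jx /=.
have -> : ((wprod (rcons x i))^-1 * w = s i * v)%g.
  rewrite -cats1 wprod_cat wprod_cons wprod_nil mulg1 invMg simple_inv.
  by rewrite -mulgA.
by rewrite addSnnS; apply: leq_trans xw; rewrite leq_add2l.
Qed.

Lemma word_shorten (x : seq 'I_n) : ~~ sorted [rel a b | a != b] x ->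
  exists2 y, wprod y = wprod x & (size y < size x)%N.
Proof.
elim: x => // a [|b x] IH //=; rewrite negb_and negbK => /orP[/eqP <-|nx].
  by exists x; [rewrite !wprod_cons simpleK|exact: leqW].
by have [y yx sy] := IH nx; exists (a :: y); rewrite //= wprod_cons yx -wprod_cons.
Qed.

Lemma alt_cat i j p q : exists r, alt i j (p + q) = alt i j p ++ r.
Proof.
elim: p i j => [|p IH] i j; first by exists (alt i j q).
by have [r e] := IH j i; exists r; rewrite addSn /= e.
Qed.

(** A left descent j of [w] differs from [i]. Split off a longest prefix in s_i and s_j: it
    alternates, starts with s_j and is shorter than the exponent, so it sends e_i to a nonnegative
    combination of e_i and e_j. The induction hypothesis applies to the shorter remainder, which
    neither s_i nor s_j shortens. *)
Lemma tits_positive (w : W) i : (len w <= len (s i * w))%N ->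
  forall l, 0 <= (e_ i *m rho w) 0 l.
Proof.
have [N] := ubnP (len w); elim: N w i => // N IH w i; rewrite ltnS => wN li.
case: (pickP (fun j => (len (s j * w) < len w)%N)) => [j lj|none]; last first.
  have [[|j y] yw sy] := len_word w.
    by move=> l; rewrite -yw wprod_nil rho1 mulmx1 mxE; case: (_ && _).
  have := none j; rewrite -sy -yw wprod_cons simpleK /= ltnS.
  by rewrite len_wprod.
have ji : j != i by apply: contraTneq lj => ->; rewrite -leqNgt.
have ij : i != j by rewrite eq_sym.
have Ji : mem [:: i; j] i by exact: mem_head.
have Jj : mem [:: i; j] j by rewrite -[mem _ _]/(_ \in _) !inE eqxx orbT.
have [x [v [Jx x0 wE sx vmin]]] := word_max Jj lj.
have vw : (len v < len w)%N by rewrite -sx -addn1 addnC leq_add2r.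
have vi := IH v i (leq_trans vw wN) (vmin i Ji).
have vj := IH v j (leq_trans vw wN) (vmin j Jj).
have xmin y : wprod y = wprod x -> (size x <= size y)%N.
  by move=> e; rewrite -(leq_add2r (len v)) sx wE -e len_mul.
have xi y : wprod y = (s i * wprod x)%g -> (size x <= size y)%N.
  move=> e; rewrite -(leq_add2r (len v)) sx (leq_trans li) // wE mulgA -e.
  exact: len_mul.
have xs : sorted [rel a b | a != b] x.
  apply: contraT => /word_shorten[y /xmin]; by rewrite leqNgt => /negbTE ->.
have xE : x = alt j i (size x).
  move: {vw sx wE} x0 xi xs Jx; case: {xmin} x => // a x _ xi xs /andP[aij Jx].
  have ea : a = j.
    have : a \in [:: i; j] by exact: aij.
    rewrite !inE => /orP[] /eqP // e.
    by have := xi x; rewrite e wprod_cons simpleK => /(_ erefl); rewrite ltnn.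
  rewrite ea in xs *; rewrite {1}(@alt_of_word j i x) //.
  by apply: sub_all Jx => b; rewrite -![mem _ _]/(_ \in _) !inE orbC.
(* A prefix as long as the exponent could be rewritten by the braid relation to start with s_i,
   which would then shorten it, against [xi]. *)
have xk : (size x < exponent m i j)%N.
  rewrite ltnNge; apply/negP => /subnKC xk.
  have [r er] := alt_cat j i (exponent m i j) (size x - exponent m i j).
  rewrite xk -xE in er; have e0 := exponentP m_crys ij.
  move: er (alt_braid ij) xk; case: (exponent m i j) e0 => // k _ er br xk.
  have ex : wprod x = (s i * wprod (alt j i k ++ r))%g.
    by rewrite {1}er wprod_cat -br [alt i j k.+1]/= wprod_cons -mulgA -wprod_cat.
  have := xi (alt j i k ++ r); rewrite ex simpleK => /(_ erefl).
  by rewrite {1}er !size_cat !size_alt leqNgt addSn ltnSn.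
have [p [q [p0 q0 act]]] := alt_action ij xk.
rewrite wE rhoM mulmxA xE act mulmxDl -!scalemxAl.
exact: row_nonneg_comb.
Qed.

(** If a reduced word of [w] starts with s_i, then s_i does not shorten s_i w, so e_i rho(s_i w) is
    nonnegative; for trivial rho w it would be - e_i. *)
Lemma rho_faithful w : rho w = 1%:M -> w = 1%g.
Proof.
move=> rw; have [[|i y] yw sy] := len_word w; first by rewrite -yw wprod_nil.
have : (len (s i * w) <= len (s i * (s i * w)))%N.
  rewrite simpleK -sy -yw wprod_cons simpleK; apply: leq_trans (len_wprod _) _.
  exact: leqnSn.
move/tits_positive => /(_ i); rewrite rhoM rho_simple rw mulmx1 simple_mxE.
by rewrite coroot_form_simple cartan_int_diag !mxE !eqxx.
Qed.
(** The standard scalar product, summed over W rather than averaged in order to stay integral. *)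
Definition inv_form (u v : 'rV[int]_n) : int :=
  (u *m (\sum_(w : W) rho w *m (rho w)^T) *m v^T) 0 0.
Local Notation B := inv_form.

Lemma inv_formE u v : B u v = \sum_(w : W) (u *m rho w *m (v *m rho w)^T) 0 0.
Proof.
rewrite /inv_form mulmx_sumr mulmx_suml summxE; apply: eq_bigr => w _.
by rewrite trmx_mul !mulmxA.
Qed.

Lemma inv_form_rho u v w : B (u *m rho w) (v *m rho w) = B u v.
Proof.
rewrite !inv_formE [RHS](reindex_inj (mulgI w)) /=.
by apply: eq_bigr => x _; rewrite rhoM !mulmxA.
Qed.

Lemma inv_formC u v : B u v = B v u.
Proof.
rewrite !inv_formE; apply: eq_bigr => w _.
by rewrite -[in LHS](trmxK (u *m rho w)) -trmx_mul mxE.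
Qed.

Lemma inv_form_linear k u v w : B (k *: u + v) w = k * B u w + B v w.
Proof. by rewrite /inv_form !mulmxDl -!scalemxAl !mxE. Qed.

Lemma row_sqr_ge0 (u : 'rV[int]_n) : 0 <= (u *m u^T) 0 0.
Proof. by rewrite mxE sumr_ge0 // => k _; rewrite mxE sqr_ge0. Qed.

Lemma inv_form_gt0 u : u != 0 -> 0 < B u u.
Proof.
move=> u0; rewrite inv_formE (bigD1 1%g) //= rho1 mulmx1.
rewrite ltr_pwDl ?sumr_ge0 // => [|w _]; last exact: row_sqr_ge0.
rewrite lt_neqAle row_sqr_ge0 andbT eq_sym; apply: contraNneq u0.
rewrite mxE => /eqP; rewrite psumr_eq0 => [/allP u0|k _]; last by rewrite mxE sqr_ge0.
apply/eqP/rowP => k; have := u0 k (mem_index_enum _).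
by rewrite !mxE mulf_eq0 orbb => /eqP.
Qed.

(** Invariance under s_i, which negates e_i, already implies that the form symmetrizes the chosen
    Cartan matrix. *)
Lemma inv_form_simple v i : 2 * B v (e_ i) = coroot_form m i v * B (e_ i) (e_ i).
Proof.
have := inv_form_rho v (e_ i) (s i); rewrite rho_simple !simple_mxE.
rewrite coroot_form_simple cartan_int_diag.
have -> : e_ i - 2 *: e_ i = -1 *: e_ i.
  by rewrite -{1}[e_ i]scale1r -scalerBl.
have -> : v - coroot_form m i v *: e_ i = - coroot_form m i v *: e_ i + v.
  by rewrite scaleNr addrC.
have B0 u : B 0 u = 0 by rewrite /inv_form !mul0mx mxE.
have BN u : B u (-1 *: e_ i) = - B u (e_ i).
  by rewrite inv_formC -[-1 *: e_ i]addr0 inv_form_linear B0 inv_formC; ring.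
by rewrite inv_form_linear !BN; lia.
Qed.

(* W acts on rows from the right, so that s i ^ w is the reflection in e_i w. *)
Definition is_root (b : 'rV[int]_n) := exists i w, b = e_ i *m rho w.

Lemma rhoK w : rho w *m rho (w^-1)%g = 1%:M.
Proof. by rewrite -rhoM mulgV. Qed.

Lemma rhoVK w : rho (w^-1)%g *m rho w = 1%:M.
Proof. by rewrite -rhoM mulVg. Qed.

Lemma simple_root_neq0 i : e_ i != 0.
Proof.
by apply/eqP => /rowP/(_ i); rewrite !mxE !eqxx.
Qed.

Lemma is_root_neq0 v : is_root v -> v != 0.
Proof.
move=> [i [w ->]]; apply: contraNneq (simple_root_neq0 i) => e.
by rewrite -[e_ i]mulmx1 -(rhoK w) mulmxA e mul0mx.
Qed.

Lemma root_form v i w :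
  2 * B v (e_ i *m rho w) = coroot_form m i (v *m rho (w^-1)%g) * B (e_ i *m rho w) (e_ i *m rho w).
Proof.
rewrite inv_form_rho -inv_form_simple -[v in LHS]mulmx1 -(rhoVK w) mulmxA.
by rewrite inv_form_rho.
Qed.

Lemma root_cart v i w : cart B v (e_ i *m rho w) = coroot_form m i (v *m rho (w^-1)%g).
Proof.
rewrite /cart root_form mulzK // gt_eqF // inv_form_gt0 //.
by apply: is_root_neq0; exists i, w.
Qed.

Lemma root_reflE v i w : refl B (e_ i *m rho w) v = v *m rho (s i ^ w)%g.
Proof.
rewrite /refl root_cart conjgE !rhoM rho_simple !mulmxA simple_mxE mulmxBl.
by rewrite -[v *m _ *m _]mulmxA rhoVK mulmx1 -scalemxAl.
Qed.

Lemma weyl_crystallographic : crystallographic B is_root.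
Proof.
split.
- exact: inv_formC.
- exact: inv_form_linear.
- exact: inv_form_gt0.
- exact: is_root_neq0.
- by move=> u _ _ [i [w ->]]; rewrite root_form dvdz_mull.
- move=> _ _ [i [w ->]] [j [w' ->]]; exists i, (w * s j ^ w')%g.
  by rewrite root_reflE rhoM mulmxA.
(* Moving the doubled root to e_j makes the coordinate 1 even. *)
move=> _ [i [w ->]] [j [w' e]].
have : (2 *: (e_ i *m rho w *m rho (w'^-1)%g)) 0 j = 1.
  by rewrite scalemxAl e -mulmxA rhoK mulmx1 mxE !eqxx.
by rewrite mxE; lia.
Qed.
Lemma root_opp_rho i w : - (e_ i *m rho w) = e_ i *m rho (s i * w)%g.
Proof.
rewrite rhoM mulmxA rho_simple simple_mxE coroot_form_simple cartan_int_diag.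
by rewrite -{2}[e_ i]scale1r -scalerBl -scaleN1r -scalemxAl.
Qed.

Lemma rho_inj : injective rho.
Proof.
move=> x y e; apply/eqP; rewrite eq_mulgV1; apply/eqP/rho_faithful.
by rewrite rhoM e rhoK.
Qed.

(** Faithfulness enters here: a root determines its reflection as an element of W, not only as a
    matrix. *)
Lemma root_reflection_inj i i' w w' : e_ i *m rho w = e_ i' *m rho w' ->
  (s i ^ w)%g = (s i' ^ w')%g.
Proof.
move=> e; apply: rho_inj; apply/row_matrixP => k; rewrite !rowE.
by rewrite -!root_reflE e.
Qed.

(** * Irredundant generating sets of reflections *)

Section MinimalGenerators.
Variable Y : {set W}.
Hypothesis Ygen : <<Y>>%g = [set: W].
Hypothesis Ymin : forall t, t \in Y -> t \notin <<Y :\ t>>%g.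
Variables (ix : 'I_#|Y| -> 'I_n) (wx : 'I_#|Y| -> W).
Hypothesis YE : forall k, enum_val k = (s (ix k) ^ wx k)%g.
Let x k : 'rV[int]_n := e_ (ix k) *m rho (wx k).
Let X : 'M[int]_(#|Y|, n) := \matrix_k x k.

(** Fewer than n roots admit a nonzero vector orthogonal to all of them. It is fixed by the
    generators, hence by W, so it is orthogonal to every e_i and thus to itself. *)
Lemma card_generators_ge : (n <= #|Y|)%N.
Proof.
rewrite leqNgt; apply/negP => Yn.
have [v v0 vA] := int_kernel ((\sum_(w : W) rho w *m (rho w)^T) *m X^T) Yn.
have vx k : B v (x k) = 0.
  have := congr1 (fun M : 'rV[int]_#|Y| => M 0 k) vA; rewrite mulmxA !mxE => <-.
  by rewrite /inv_form mxE; apply: eq_bigr => l _; rewrite !mxE.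
pose S := [set w | v *m rho w == v].
have gS : group_set S.
  apply/group_setP; split; first by rewrite inE rho1 mulmx1.
  by move=> a b; rewrite !inE rhoM mulmxA => /eqP -> /eqP ->.
have vW w : v *m rho w = v.
  have : w \in <<Y>>%g by rewrite Ygen inE.
  suff YS : Y \subset Group gS.
    by rewrite -gen_subG in YS => /(subsetP YS); rewrite inE => /eqP.
  apply/subsetP => t tY; rewrite inE -(enum_rankK_in tY tY) YE -root_reflE.
  by rewrite /refl /cart vx mulr0 div0z scale0r subr0.
have ve i : B v (e_ i) = 0.
  have := vW (s i); rewrite rho_simple simple_mxE => /eqP.
  rewrite -subr_eq0 addrAC subrr add0r oppr_eq0 => /eqP/rowP/(_ i).
  rewrite !mxE !eqxx mulr1 => c0.
  by have := inv_form_simple v i; rewrite c0 mul0r; lia.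
have := inv_form_gt0 v0; suff -> : B v v = 0 by [].
rewrite {2}[v]row_sum_delta inv_formC.
have B0 u : B 0 u = 0 by rewrite /inv_form !mul0mx mxE.
by apply: (big_ind (fun u => B u v = 0)) => // [u u' e e'|i _];
  [rewrite -[u]scale1r inv_form_linear e e'|
   rewrite -[_ *: _]addr0 inv_form_linear B0 inv_formC ve]; rewrite mulr0.
Qed.

(** Induction on the support. With signs absorbed into the roots, either the relation is a circuit,
    whose redundant root contradicts [Ymin], or a second relation, not proportional to it, allows
    one index to be eliminated. *)
Lemma relation_absurd (d : 'I_#|Y| -> int) :
  (exists k, d k != 0) -> \sum_k d k *: x k = 0 -> False.
Proof.
have [N] := ubnP #|[pred k | d k != 0]|; elim: N d => // N IH d.
rewrite ltnS => dN [k0 dk0] d0.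
pose x' k := if d k < 0 then - x k else x k.
pose sg k : int := if d k < 0 then -1 else 1.
have sg2 k : sg k * sg k = 1 by rewrite /sg; case: ifP.
have x'E k : x' k = sg k *: x k.
  by rewrite /x' /sg; case: ifP; rewrite ?scaleN1r ?scale1r.
have rx k : is_root (x k) by exists (ix k), (wx k).
have C : circuit is_root x' (fun k => `|d k|).
  split.
  - move=> k; rewrite /x'; case: ifP => _ //.
    exact: (root_opp weyl_crystallographic).
  - by move=> k; exact: normr_ge0.
  - by exists k0; rewrite normr_gt0.
  - rewrite -[RHS]d0; apply: eq_bigr => k _; rewrite x'E scalerA /sg.
    by congr (_ *: _); case: ifP; lia.
  move=> e supp e0 i j; apply/eqP; apply: contraT => ne; exfalso.
  pose e' k := sg k * e k.
  have e'0 : \sum_k e' k *: x k = 0.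
    by rewrite -[RHS]e0; apply: eq_bigr => k _; rewrite x'E scalerA mulrC.
  have supp' k : d k = 0 -> e k = 0 by move=> dk; apply: supp; rewrite dk normr0.
  pose r k := e' k * d j - e' j * d k.
  have absE k : `|d k| = sg k * d k by rewrite /sg; case: ifP; lia.
  have dj : d j != 0.
    by apply: contraNneq ne => dj; rewrite dj (supp' j dj) normr0 mulr0 mul0r.
  apply: (IH r).
  - rewrite (leq_trans _ dN) //; apply: proper_card; apply/properP; split.
      apply/subsetP => k; rewrite !inE; apply: contraNneq => dk.
      by rewrite /r /e' dk (supp' k dk) !mulr0 mul0r subrr.
    by exists j; rewrite !inE // /r subrr eqxx.
  - exists i; apply: contraNneq ne; rewrite /r /e' !absE => ri.
    have : sg i * sg j * (sg i * e i * d j - sg j * e j * d i) = 0 by rewrite ri mulr0.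
    have -> : sg i * sg j * (sg i * e i * d j - sg j * e j * d i) =
        (sg i * sg i) * (e i * (sg j * d j)) - (sg j * sg j) * (e j * (sg i * d i)) by ring.
    by rewrite !sg2 !mul1r => /eqP; rewrite subr_eq0.
  transitivity (d j *: (\sum_k e' k *: x k) - e' j *: (\sum_k d k *: x k)).
    rewrite !scaler_sumr -sumrB; apply: eq_bigr => k _.
    by rewrite /r scalerBl !scalerA (mulrC (d j)).
  by rewrite e'0 d0 !scaler0 subr0.
have [l dl red] := circuit_redundant weyl_crystallographic C.
pose t := enum_val l; pose H := <<Y :\ t>>%g.
pose Z b := exists i w, b = e_ i *m rho w /\ (s i ^ w)%g \in H.
have ZN b : Z b -> Z (- b).
  move=> [i [w [-> iH]]]; exists i, (s i * w)%g; rewrite root_opp_rho; split=> //.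
  by rewrite conjgM [(s i ^ s i)%g]conjgE mulgA mulVg mul1g.
have : Z (x' l).
  apply: red.
    move=> _ _ _ _ [i [w [-> iH]]] [j [u [-> jH]]].
    exists i, (w * (s j ^ u))%g; rewrite root_reflE rhoM mulmxA; split=> //.
    by rewrite conjgM groupJ.
  move=> j jl _; have Zj : Z (x j).
    exists (ix j), (wx j); split=> //; rewrite -YE; apply: mem_gen.
    by rewrite !inE (inj_eq enum_val_inj) jl enum_valP.
  by rewrite /x'; case: ifP => // _; exact: ZN.
have Zl : Z (x' l) -> Z (x l).
  by rewrite /x'; case: ifP => // _ /ZN; rewrite opprK.
move=> /Zl[i [w [/root_reflection_inj]]]; rewrite -YE => <-.
by apply/negP; apply: Ymin; exact: enum_valP.
Qed.

Lemma card_generators : #|Y| = n.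
Proof.
apply/eqP; rewrite eqn_leq card_generators_ge andbT leqNgt; apply/negP => nY.
have [d d0 dX] := int_kernel X nY.
apply: (@relation_absurd (fun k => d 0 k)).
  by have /rV0Pn := d0.
by rewrite -[RHS]dX mulmx_sum_row; apply: eq_bigr => k _; rewrite rowK.
Qed.
End MinimalGenerators.
End Representation.
End Weyl.

Theorem corollary3p6 (W : finGroupType) (n : nat) (s : 'I_n -> W) :
  weyl_group s -> minimum_equals_minimal s.
Proof.
move=> [m cox crys] X Xr Xgen.
pose gens (Y : {set W}) := (Y \subset X) && (<<Y>>%g == [set: W]).
have gX : gens X by rewrite /gens subxx Xgen eqxx.
case: (@arg_minnP _ X gens (fun Y => #|Y|) gX) => Y /andP[YX /eqP Ygen] Ymin.
exists Y; split=> //.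
have Yr : Y \subset reflections s := subset_trans YX Xr.
have Ymin' t : t \in Y -> t \notin <<Y :\ t>>%g.
  move=> tY; apply/negP => tg; have /Ymin : gens (Y :\ t).
    rewrite /gens (subset_trans (subsetDl _ _) YX) /= eqEsubset subsetT /= -Ygen gen_subG.
    apply/subsetP => u uY; have [->//|ut] := eqVneq u t.
    by apply: mem_gen; rewrite !inE ut.
  by rewrite (cardsD1 t Y) tY add1n ltnn.
have sP i : inverse_pair (simple_mx m i, simple_mx m i).
  by rewrite /inverse_pair /= simple_mxK eqxx.
pose r i := Glz (sP i).
have [|f fM fs] := @coxeter_univ _ _ _ _ cox (glz n) r.
  split=> [i|i j ij]; apply: glz_mx_inj.
    by rewrite expgS expg1 glz_mxM simple_mxK.
  have := @simple_mx_braid n m crys i j (negbT (ltn_eqF ij)).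
  by rewrite /exponent ij glz_mxX.
have f1 : f 1%g = 1%g by apply: (mulgI (f 1%g)); rewrite -fM !mulg1.
have /fin_all_exists[p pE] : forall k : 'I_#|Y|, exists p, enum_val k = (s p.1 ^ p.2)%g.
  move=> k; have /imset2P[_ w /imsetP[i _ ->] _ ->] := subsetP Yr _ (enum_valP k).
  by exists (i, w).
pose rho w := glz_mx (f w).
have rho1 : rho 1%g = 1%:M by rewrite /rho f1.
have rhoM x y : rho (x * y)%g = rho x *m rho y by rewrite /rho fM.
have rho_simple i : rho (s i) = simple_mx m i by rewrite /rho fs.
exact: (card_generators cox crys rho1 rhoM rho_simple Ygen Ymin' pE).
Qed.
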